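(* Let $\theta_\star\in\mathbb{R}^d$ and suppose $Z\sim\mathbb{P}^{(n)}_{\theta_\star}(dz)=f_{n,\theta_\star}(z)\,dz$. Suppose that for all $z\in\mathcal{Z}^{(n)}$ the map $\theta\mapsto\log q_{n,\theta}(z)$ is concave and differentiable on $\mathbb{R}^d$. Suppose that the prior weights satisfy $\pi_\delta=g_{\|\delta\|_0}\binom{d}{\|\delta\|_0}^{-1}$, $\delta\in\{0,1\}^d$, for a probability distribution $\{g_s,\,0\le s\le d\}$ for which there are positive constants $c_1,c_2,c_3,c_4$ with $c_3\ge c_4$ such that $\frac{c_1}{d^{c_3}}g_{s-1}\le g_s\le\frac{c_2}{d^{c_4}}g_{s-1}$ for $s=1,\dots,d$. Set $s_\star=\|\theta_\star\|_0$ and suppose $d^{c_4}\ge 8c_2$. Let $\bar\Theta\supseteq\Theta_\star$ be a split cone, $\bar L\ge0$, $\bar\lambda\ge0$, and let $\mathsf{r}$ be a rate function such that $\bar\epsilon:=\phi_{\mathsf{r}}(2\bar\lambda)$ is finite. (1) Set $\mathcal{E}_n:=\mathcal{E}_{n,0}(\mathbb{R}^d,\rho)\cap\hat{\mathcal{E}}_{n,1}(\Theta_\star,\bar L)\cap\check{\mathcal{E}}_{n,1}(\mathcal{N},\mathsf{r})$. Then for any integer $k\ge0$, $$\mathbb{E}^{(n)}\left[\check\Pi_{n,d}\left(\{\theta\in\mathbb{R}^d:\|\theta\|_0\ge s_\star+k\}\,|\,Z\right)\right]\le\mathbb{P}^{(n)}[Z\notin\mathcal{E}_n]+2e^{\mathsf{a}}\left(4+\frac{4\bar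 L}{\rho^2}\right)^{s_\star}\binom{d}{s_\star}\left(\frac{4c_2}{d^{c_4}}\right)^k,$$ where $\mathsf{a}=-\frac12\inf_{x>0}\left[\mathsf{r}(x)-4\rho\sqrt{s_\star}\,x\right]$ if $\mathcal{N}\ne\emptyset$, and $\mathsf{a}=0$ if $\mathcal{N}=\emptyset$. (2) Set $\mathcal{E}_n:=\mathcal{E}_{n,0}(\bar\Theta,\bar\lambda)\cap\hat{\mathcal{E}}_{n,1}(\Theta_\star,\bar L)\cap\check{\mathcal{E}}_{n,1}(\bar\Theta,\mathsf{r})$. For any $M_0>2$, $$\mathbb{E}^{(n)}\left[\check\Pi_{n,d}\left(\{\theta\in\theta_\star+\bar\Theta:\|\theta-\theta_\star\|_2>M_0\bar\epsilon\}\,|\,Z\right)\right]\le\mathbb{P}^{(n)}[Z\notin\mathcal{E}_n]+\sum_{j\ge1}\mathsf{D}_j\,e^{-\frac18\mathsf{r}\left(\frac{jM_0\bar\epsilon}{2}\right)}$$ $$+\,2\binom{d}{s_\star}\left(\frac{d^{c_3}}{c_1}\right)^{s_\star}\left(1+\frac{\bar L}{\rho^2}\right)^{s_\star}\sum_{j\ge1}e^{-\frac18\mathsf{r}\left(\frac{jM_0\bar\epsilon}{2}\right)}e^{3\rho c_0jM_0\bar\epsilon},$$ where $\mathsf{D}_j:=\mathsf{D}\left(\frac{jM_0\bar\epsilon}{2},\mathsf{B}_d(\bar\Theta,(j+1)M_0\bar\epsilon)\right)$ and $c_0:=\sup_{u\in\bar\Theta}\ \sup_{v\in\bar\Theta,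\,\|v\|_2=1}|\langle\mathrm{sign}(u),v\rangle|$.
   Context: Sample space and quasi-likelihood: $\mathcal{Z}^{(n)}$ is a sample space with a reference sigma-finite measure $dz$; $f_{n,\theta_\star}$ is a probability density with respect to $dz$; $\mathbb{P}^{(n)}=\mathbb{P}^{(n)}_{\theta_\star}$ is the law of $Z$ and $\mathbb{E}^{(n)}$ the expectation under it. $(\theta,z)\mapsto q_{n,\theta}(z)$ is a jointly measurable positive function on $\mathbb{R}^d\times\mathcal{Z}^{(n)}$ with $0<\int_{\mathbb{R}^d}q_{n,\theta}(z)\,\Pi(d\theta)<\infty$ for $dz$-almost every $z$. $\nabla\log q_{n,u}(z)$ is the gradient of $\theta\mapsto\log q_{n,\theta}(z)$ at $u$. Prior and quasi-posterior: $\{\pi_\delta\}$ is a probability distribution on $\Delta_d=\{0,1\}^d$ and $\rho>0$. For $\delta\in\Delta_d$, $\mu_{d,\delta}(d\theta)=\prod_{j=1}^d\nu_{\delta_j}(d\theta_j)$ with $\nu_0$ the Dirac mass at $0$ and $\nu_1$ Lebesgue measure on $\mathbb{R}$. The prior is $\Pi(d\theta)=\sum_{\delta\in\Delta_d}\pi_\delta(\rho/2)^{\|\delta\|_0}e^{-\rho\|\theta\|_1}\mu_{d,\delta}(d\theta)$ (given $\delta$, the components are independent, equal to $0$ if $\delta_j=0$ and Laplace with density $(\rho/2)e^{-\rho|x|}$ if $\delta_j=1$). The quasi-posterior is $\check\Pi_{n,d}(A|Z)=\int_Aq_{n,\theta}(Z)\Pi(d\theta)\big/\int_{\mathbb{R}^d}q_{n,\theta}(Z)\Pi(d\theta)$.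 Notation: $\langle\cdot,\cdot\rangle$ is the Euclidean inner product; $\|\theta\|_0$ is the number of nonzero components; $\|\cdot\|_1,\|\cdot\|_2$ are the usual norms; $\theta\cdot\theta'$ is the componentwise product; $\mathrm{sign}$ acts componentwise with $\mathrm{sign}(0)=0$; $\theta+A=\{\theta+u:u\in A\}$. $\delta_\star\in\Delta_d$ is given by $\delta_{\star j}=1$ if $\theta_{\star j}\neq0$ and $0$ otherwise. Rate function: a continuous strictly increasing $\mathsf{r}:[0,\infty)\to[0,\infty)$ with $\mathsf{r}(0)=0$ and $\lim_{x\downarrow0}\mathsf{r}(x)/x=0$. For $a\ge0$, $\phi_{\mathsf{r}}(a)=\inf\{x>0:\mathsf{r}(z)\ge az\text{ for all }z\ge x\}$, with $\inf\emptyset=+\infty$. Split cone: a nonempty $\Theta\subseteq\mathbb{R}^d$ such that $\lambda x\in\Theta$ for all $\lambda\ge0$, $x\in\Theta$, and $u\cdot x\in\Theta$ for all $x\in\Theta$, $u\in\{-1,1\}^d$. Set $\Theta_\star=\{\theta\in\mathbb{R}^d:\theta_j=0\text{ for all }j\text{ with }\theta_{\star j}=0\}$ and $\mathcal{N}=\{\theta\in\mathbb{R}^d:\theta\ne0,\ \sum_{j:\delta_{\star j}=0}|\theta_j|\le7\|\theta\cdot\delta_\star\|_1\}$. Good sets: let $\mathcal{L}_{n,\theta}(z)=\log q_{n,\theta}(z)-\log q_{n,\theta_\star}(z)-\langle\nabla\log q_{n,\theta_\star}(z),\theta-\theta_\star\rangle$. For $\Theta\subseteq\mathbb{R}^d$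 a split cone or $\Theta=\mathcal{N}$, a rate function $\mathsf{r}$, $L\ge0$ and $\lambda\ge0$: $\check{\mathcal{E}}_{n,1}(\Theta,\mathsf{r})=\{z:\mathcal{L}_{n,\theta}(z)\le-\frac12\mathsf{r}(\|\theta-\theta_\star\|_2)\text{ for all }\theta\in\theta_\star+\Theta\}$; $\hat{\mathcal{E}}_{n,1}(\Theta,L)=\{z:\mathcal{L}_{n,\theta}(z)\ge-\frac L2\|\theta-\theta_\star\|_2^2\text{ for all }\theta\in\theta_\star+\Theta\}$; $\mathcal{E}_{n,0}(\Theta,\lambda)=\{z:\sup_{u\in\Theta,\|u\|_2=1}|\langle\nabla\log q_{n,\theta_\star}(z),u\rangle|\le\frac\lambda2\}$ for split cones $\Theta\ne\mathbb{R}^d$, while in part (1) the set $\mathcal{E}_{n,0}(\mathbb{R}^d,\rho)$ denotes $\{z:\|\nabla\log q_{n,\theta_\star}(z)\|_\infty\le\frac\rho2\}$, where $\|u\|_\infty=\max_j|u_j|$. (If in part (2) $\bar\Theta=\mathbb{R}^d$, $\mathcal{E}_{n,0}(\bar\Theta,\bar\lambda)$ is the set with the supremum over $\|u\|_2=1$.) Packing numbers: $\mathsf{B}_d(\Theta,M)=\{\theta\in\theta_\star+\Theta:\|\theta-\theta_\star\|_2\le M\}$, and $\mathsf{D}(\epsilon,\mathsf{B}_d(\Theta,M))$ is the maximal number of points of $\mathsf{B}_d(\Theta,M)$ with pairwise $\|\cdot\|_2$-distance at least $\epsilon$. *)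

(* Defs.v *)
From HB Require Import structures.
From mathcomp Require Import all_boot all_order all_algebra finmap.
From mathcomp Require Import all_classical all_reals all_analysis.
From mathcomp Require Import measurable_realfun.
Set Implicit Arguments.
Unset Strict Implicit.
Unset Printing Implicit Defensive.
Import Order.TTheory GRing.Theory Num.Theory.
Import numFieldNormedType.Exports.
Local Open Scope classical_set_scope.
Local Open Scope ring_scope.

(* The library has no sigma-algebra on matrices.  On row vectors we take the
   one generated by the coordinates; for real entries it is the Borel one. *)
Definition measure_rV_display : measure_display -> measure_display.
Proof. exact. Qed.

Section measurable_rV.
Context {d} {T : measurableType d}.
Variable n : nat.

Let coors : 'I_n -> 'rV[T]_n -> T := fun i v => v ord0 i.

Let rV_set0 : g_sigma_preimage coors set0.
Proof. exact: sigma_algebra0. Qed.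

Let rV_setC A : g_sigma_preimage coors A -> g_sigma_preimage coors (~` A).
Proof. exact: sigma_algebraC. Qed.

Let rV_bigcup (F : _^nat) : (forall i, g_sigma_preimage coors (F i)) ->
  g_sigma_preimage coors (\bigcup_i (F i)).
Proof. exact: sigma_algebra_bigcup. Qed.

HB.instance Definition _ := @isMeasurable.Build (measure_rV_display d)
  'rV[T]_n (g_sigma_preimage coors) rV_set0 rV_setC rV_bigcup.

End measurable_rV.


Lemma measurable_rV_coord d (T : measurableType d) n (i : 'I_n) :
  measurable_fun [set: 'rV[T]_n] (fun v => v ord0 i).
Proof.
move=> _ Y mY; rewrite setTI; apply: sub_sigma_algebra => /=.
rewrite -bigcup_seq/=; exists i => /=; first by rewrite mem_index_enum.
by exists Y => //; rewrite setTI.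
Qed.

Lemma measurable_fun_rVP d1 d2 (T1 : measurableType d1)
    (T2 : measurableType d2) n (f : T1 -> 'rV[T2]_n) :
  measurable_fun [set: T1] f <->
  forall i, measurable_fun [set: T1] (fun x => f x ord0 i).
Proof.
split=> [mf i|mf].
  exact: (measurableT_comp (measurable_rV_coord i) mf).
have : g_sigma_preimage (fun i => (fun v : 'rV[T2]_n => v ord0 i) \o f)
    `<=` measurable.
  apply: smallest_sub; first exact: sigma_algebra_measurable.
  case: n => [|n] in f mf *; first by rewrite big_ord0.
  rewrite -bigcup_mkord_ord; apply: bigcup_sub => i Ii.
  by move=> A [B mB <-]; exact: mf.
by rewrite g_sigma_preimage_comp => prefS _ A mA; apply: prefS; exists A.
Qed.

Section cons_measure.
Context {R : realType} {n : nat}.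

Definition cons_rV (p : measurableTypeR R * 'rV[R]_n) : 'rV[R]_n.+1 :=
  \row_i (if unlift ord0 i is Some j then p.2 ord0 j else p.1).

Lemma measurable_cons_rV : measurable_fun setT cons_rV.
Proof.
apply/measurable_fun_rVP => i; under eq_fun do rewrite mxE.
case: unliftP => [j _|_]; last exact: measurable_fst.
exact: (measurableT_comp (measurable_rV_coord j) measurable_snd).
Qed.

Variables (nu : {sigma_finite_measure set (measurableTypeR R) -> \bar R})
          (m : {measure set 'rV[R]_n -> \bar R}).

Definition cons_measure : set 'rV[R]_n.+1 -> \bar R :=
  pushforward (nu \x^ m)%E cons_rV.

Let cons_measure0 : cons_measure set0 = 0%E.
Proof. by rewrite /cons_measure /pushforward preimage_set0 measure0. Qed.

Let cons_measure_ge0 A : (0 <= cons_measure A)%E.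
Proof. by rewrite /cons_measure /pushforward; exact: measure_ge0. Qed.

Let cons_measure_sigma_additive : semi_sigma_additive cons_measure.
Proof.
move=> F mF tF mUF; rewrite /cons_measure /pushforward preimage_bigcup.
have mpre A : measurable A -> measurable (cons_rV @^-1` A).
  by move=> mA; rewrite -[X in measurable X]setTI; exact: measurable_cons_rV.
apply: measure_semi_sigma_additive.
- by move=> k; exact: mpre.
- apply/trivIsetP => /= i j _ _ ij; rewrite -preimage_setI.
  by move/trivIsetP : tF => /(_ _ _ _ _ ij) ->//; rewrite preimage_set0.
- by rewrite -preimage_bigcup; exact: mpre.
Qed.

HB.instance Definition _ := isMeasure.Build _ _ _ cons_measure
  cons_measure0 cons_measure_ge0 cons_measure_sigma_additive.

End cons_measure.

Section vectors.
Context {R : realType} {d : nat}.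
Implicit Types u v : 'rV[R]_d.

Definition dot u v : R := \sum_(j < d) u ord0 j * v ord0 j.
Definition l0 u : nat := #|[pred j | u ord0 j != 0]|.
Definition l1 u : R := \sum_(j < d) `|u ord0 j|.
Definition l2 u : R := Num.sqrt (\sum_(j < d) u ord0 j ^+ 2).
Definition hadamard u v : 'rV[R]_d := map2_mx *%R u v.
Definition sgn u : 'rV[R]_d := map_mx Num.sg u.

Definition grad (h : 'rV[R]_d -> R) u : 'rV[R]_d :=
  \row_j 'D_(delta_mx ord0 j) h u.

Lemma measurable_l1 : measurable_fun setT l1.
Proof.
apply: measurable_sum => j; apply: measurableT_comp => //.
exact: measurable_rV_coord.
Qed.

End vectors.

Section prior.
Context {R : realType}.

Fixpoint prod_measure (n : nat) :
    ('I_n -> {sigma_finite_measure set (measurableTypeR R) -> \bar R}) ->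
    {measure set 'rV[R]_n -> \bar R} :=
  match n with
  | 0%N => fun _ => [the {measure set 'rV[R]_0 -> \bar R}
                     of dirac (0 : 'rV[R]_0)]
  | n'.+1 => fun nu => [the {measure set 'rV[R]_n'.+1 -> \bar R} of
      cons_measure (nu ord0) (prod_measure (fun i => nu (lift ord0 i)))]
  end.

Definition spike_slab (b : bool) :
    {sigma_finite_measure set (measurableTypeR R) -> \bar R} :=
  if b then [the {sigma_finite_measure set (measurableTypeR R) -> \bar R}
             of lebesgue_measure]
  else [the {sigma_finite_measure set (measurableTypeR R) -> \bar R}
        of dirac (0 : measurableTypeR R)].

Context {d : nat}.

(* The measure mu_(d, delta) of the prior. *)
Definition model_measure (delta : {ffun 'I_d -> bool}) :
    {measure set 'rV[R]_d -> \bar R} :=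
  prod_measure (fun j => spike_slab (delta j)).

Definition model_size (delta : {ffun 'I_d -> bool}) : nat :=
  #|[pred j | delta j]|.

Variables (w : {ffun 'I_d -> bool} -> {nonneg R}) (rho : {posnum R}).

Definition prior (A : set 'rV[R]_d) : \bar R :=
  (\sum_(delta : {ffun 'I_d -> bool})
     ((w delta)%:num * (rho%:num / 2) ^+ model_size delta)%:E *
     \int[model_measure delta]_(theta in A)
       (expR (- (rho%:num * l1 theta)))%:E)%E.

Let weight_ge0 delta :
  (0 <= ((w delta)%:num * (rho%:num / 2) ^+ model_size delta)%:E :> \bar R)%E.
Proof. by rewrite lee_fin. Qed.

Let prior0 : prior set0 = 0%E.
Proof. by rewrite /prior big1// => delta _; rewrite integral_set0 mule0. Qed.

Let prior_ge0 A : (0 <= prior A)%E.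
Proof.
apply: sume_ge0 => delta _; apply: mule_ge0 => //.
by apply: integral_ge0 => x _; rewrite lee_fin expR_ge0.
Qed.

Let prior_sigma_additive : semi_sigma_additive prior.
Proof.
move=> F mF tF mUF; rewrite [X in _ --> X](_ : _ =
    lim ((fun n => \sum_(0 <= i < n) prior (F i)) @ \oo)%E).
  by apply: is_cvg_ereal_nneg_natsum => k _; exact: prior_ge0.
have int_ge0 delta A : (0 <= \int[model_measure delta]_(theta in A)
    (expR (- (rho%:num * l1 theta)))%:E)%E.
  by apply: integral_ge0 => x _; rewrite lee_fin expR_ge0.
rewrite nneseries_sum//; last first.
  by move=> delta k _; apply: mule_ge0 => //; exact: weight_ge0.
apply: eq_bigr => /= delta _; rewrite nneseriesZl//; congr (_ * _)%E.
rewrite ge0_integral_bigcup//.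
apply: (@measurable_funS _ _ _ _ setT) => //; apply/measurable_EFinP.
apply: measurableT_comp => //; apply: measurableT_comp => //.
by apply: measurable_funM => //; exact: measurable_l1.
Qed.

HB.instance Definition _ := isMeasure.Build _ _ _ prior
  prior0 prior_ge0 prior_sigma_additive.

End prior.

(* [A] need not be measurable (a split cone need not be): the integral over
   [A] is then the library's, i.e. a lower integral.  The quotient is only
   meaningful when the denominator is in (0, +oo). *)
Definition quasi_posterior (R : realType) d disp (T : measurableType disp)
    (Pi : {measure set 'rV[R]_d -> \bar R}) (q : 'rV[R]_d -> T -> R)
    (A : set 'rV[R]_d) (z : T) : \bar R :=
  ((\int[Pi]_(theta in A) (q theta z)%:E) /
   (\int[Pi]_theta (q theta z)%:E))%E.

Section rate.
Context {R : realType}.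

(* Only the restriction of [r] to [0, +oo) is constrained. *)
Definition rate_function (r : R -> R) :=
  [/\ forall x, 0 <= x -> 0 <= r x,
      {within `[0, +oo[, continuous r},
      {in `[0, +oo[ &, {homo r : x y / x < y}},
      r 0 = 0 &
      r x / x @[x --> 0^'+] --> 0].

Definition phi_rate (r : R -> R) (a : R) : \bar R :=
  ereal_inf [set x%:E | x in
    [set x : R | 0 < x /\ forall z, x <= z -> a * z <= r z]].

End rate.

Section good_sets.
Context {R : realType} {d : nat} {disp : measure_display}
        {T : measurableType disp}.
Implicit Types (Theta : set 'rV[R]_d) (r : R -> R).

Definition split_cone Theta :=
  [/\ Theta !=set0,
      forall (l : R) (x : 'rV[R]_d), 0 <= l -> Theta x -> Theta (l *: x) &
      forall u x : 'rV[R]_d, (forall j, u ord0 j = 1 \/ u ord0 j = -1) ->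
        Theta x -> Theta (hadamard u x)].

Variable theta_star : 'rV[R]_d.

Definition translate Theta : set 'rV[R]_d :=
  [set theta_star + u | u in Theta].

Definition delta_star : {ffun 'I_d -> bool} :=
  [ffun j => theta_star ord0 j != 0].

Definition Theta_star : set 'rV[R]_d :=
  [set theta : 'rV[R]_d | forall j, theta_star ord0 j = 0 -> theta ord0 j = 0].

Definition Ncone : set 'rV[R]_d :=
  [set theta : 'rV[R]_d | theta != 0 /\
    \sum_(j < d | ~~ delta_star j) `|theta ord0 j| <=
    7 * l1 (hadamard theta (\row_j (delta_star j)%:R))].

Variable q : 'rV[R]_d -> T -> R.

Definition grad_log (z : T) : 'rV[R]_d :=
  grad (fun theta => ln (q theta z)) theta_star.

Definition Lcal (theta : 'rV[R]_d) (z : T) : R :=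
  ln (q theta z) - ln (q theta_star z)
  - dot (grad_log z) (theta - theta_star).

Definition E1_check Theta r : set T :=
  [set z | forall theta, translate Theta theta ->
    Lcal theta z <= - (r (l2 (theta - theta_star)) / 2)].

Definition E1_hat Theta (L : R) : set T :=
  [set z | forall theta, translate Theta theta ->
    - (L / 2 * l2 (theta - theta_star) ^+ 2) <= Lcal theta z].

Definition E0 Theta (lambda : R) : set T :=
  [set z | (ereal_sup [set `|dot (grad_log z) u|%:E |
              u in [set u : 'rV[R]_d | Theta u /\ l2 u = 1%R]] <= (lambda / 2)%:E)%E].

(* The norm of ['rV[R]_d] used here is the library's, i.e. the max-norm. *)
Definition E0_max (lambda : R) : set T :=
  [set z | `|grad_log z| <= lambda / 2].

Definition Bset Theta (M : R) : set 'rV[R]_d :=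
  [set theta : 'rV[R]_d | translate Theta theta /\ l2 (theta - theta_star) <= M].

(* Finite sets of distinct points; the supremum is taken in [\bar R]. *)
Definition packing (eps : R) (B : set 'rV[R]_d) : \bar R :=
  ereal_sup [set (#|` S|%fset)%:R%:E | S in [set S : {fset 'rV[R]_d} |
    [set` S] `<=` B /\
    forall x y, x \in S -> y \in S -> x != y -> eps <= l2 (x - y)]].

(* All the suprema are over sets bounded by [Num.sqrt d%:R]; [sup set0] is 0,
   the value for the null cone. *)
Definition cone_const Theta : R :=
  sup [set sup [set `|dot (sgn u) v| | v in [set v : 'rV[R]_d | Theta v /\ l2 v = 1]]
      | u in Theta].

Definition a_exponent (r : R -> R) (rho : R) : \bar R :=
  if `[< Ncone !=set0 >] then
    ((- 2^-1)%:E * ereal_inf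
      [set (r x - 4 * rho * Num.sqrt (l0 theta_star)%:R * x)%:E
      | x in [set x : R | 0 < x]%R])%E
  else 0%E.

End good_sets.

(* Main.v *)
(* On the good event the log-likelihood ratio is controlled pointwise, so no
   tests are needed.  In part (1), concavity (off the cone N) and the curvature
   bound (on N) give, with u = theta - theta_star,
     q_theta <= e^a q_theta_star exp(rho |theta|_1 - rho |theta_star|_1
                                     - (rho / 4) |u|_1).
   In part (2), r(x) >= 2 lambda x beyond eps absorbs the gradient term, so that
   q_theta / q_theta_star <= exp(- r(|u|_2) / 4) there; splitting into the shells
   j M0 eps < |u|_2 <= (j + 1) M0 eps and using |u|_1 <= c0 |u|_2 gives the same
   kind of bound with rho / 2 for rho / 4 and the second series for e^a.  Both
   integrate against the prior coordinate by coordinate.  The normalising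
   constant is bounded below on the model of theta_star, where symmetrising the
   gradient tilt (cosh >= 1) leaves one-dimensional Gauss-Laplace integrals.
   Of the packing term of part (2) only the sign is used. *)
Require Import Defs.
From HB Require Import structures.
From mathcomp Require Import all_boot all_order all_algebra finmap.
From mathcomp Require Import all_classical all_reals all_analysis.
From mathcomp Require Import measurable_realfun ring lra.
Set Implicit Arguments.
Unset Strict Implicit.
Unset Printing Implicit Defensive.
Import Order.TTheory GRing.Theory Num.Theory.
Import numFieldNormedType.Exports.
Local Open Scope classical_set_scope.
Local Open Scope ring_scope.

(** The obstacle is measurability. What survives is monotonicity of the lower integral: integrands
    are replaced by measurable majorants, and the factor of each shell is bounded by the whole
    series, so that one constant serves on all shells at once. The good events, in contrast, have to
    be proved measurable, since the probability of their complement must appear as an integral. The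
    constants come from a single coordinate. If a Laplace kernel of rate kappa remains once the
    prior density is cancelled, the prior weight rho / 2 of an active coordinate becomes rho /
    kappa, that is 4 in part (1) and 2 in part (2). Since d^c4 >= 8 c2, the sum over model sizes is
    then dominated by a geometric series of ratio at most 1/2, whence the leading factor 2. In part
    (1) this sum starts at size s + k and is compared directly with g s; in part (2) it starts at 0,
    and passing from g 0 to g s costs (d^c3 / c1)^s. *)

(** * Lower integrals and integration against a finite mixture of densities *)

Section lower_integral.
Local Open Scope ereal_scope.
Context d (T : measurableType d) (R : realType).
Variable mu : {measure set T -> \bar R}.

Import HBNNSimple.

(* The library's integral of a nonnegative nonmeasurable function is a lower
   integral, hence still monotone. *)
Lemma ge0_le_lower_integral (D : set T) (f g : T -> \bar R) :
  (forall x, D x -> 0 <= f x) -> (forall x, D x -> f x <= g x) ->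
  \int[mu]_(x in D) f x <= \int[mu]_(x in D) g x.
Proof.
move=> f0 fg; have g0 x : D x -> 0 <= g x.
  by move=> Dx; exact: le_trans (f0 _ Dx) (fg _ Dx).
rewrite !ge0_integralE//; apply: le_ereal_sup => _ [h hf <-]; exists h => // x.
by apply: (le_trans (hf x)); exact: lee_restrict.
Qed.

(** The prior is defined as a set function, and this turns it into an integration rule: a simple
    function is a combination of indicators, to which [muE] applies, and monotone convergence on
    both sides reaches every nonnegative measurable [h]. *)
Lemma ge0_integral_density (I : finType) (m : I -> {measure set T -> \bar R})
    (k : I -> {nonneg R}) (e : T -> R) :
  measurable_fun setT e -> (forall x, (0 <= e x)%R) ->
  (forall A, measurable A ->
     mu A = \sum_i (k i)%:num%:E * \int[m i]_(x in A) (e x)%:E) ->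
  forall h : T -> \bar R, measurable_fun setT h -> (forall x, 0 <= h x) ->
  \int[mu]_x h x = \sum_i (k i)%:num%:E * \int[m i]_x (h x * (e x)%:E).
Proof.
move=> me e0 muE h mh h0.
pose g := nnsfun_approx measurableT mh.
have mg n : measurable_fun setT (fun x => (g n x)%:E).
  exact/measurable_EFinP/measurable_funTS.
have g0 n x : 0 <= (g n x)%:E by rewrite lee_fin.
have gh x : (g n x)%:E @[n --> \oo] --> h x.
  by apply: (cvg_nnsfun_approx measurableT mh) => // t _; exact: h0.
have ndg x (a b : nat) : (a <= b)%N -> (g a x)%:E <= (g b x)%:E.
  by move=> ab; rewrite lee_fin; exact/lefP/nd_nnsfun_approx.
have mE : measurable_fun setT (EFin \o e) by exact/measurable_EFinP.
have gE n : \int[mu]_x (g n x)%:E =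
    \sum_i (k i)%:num%:E * \int[m i]_x ((g n x)%:E * (e x)%:E).
  have gre r i : \int[m i]_x ((r * \1_(g n @^-1` [set r]) x)%:E * (e x)%:E) =
      r%:E * \int[m i]_(x in g n @^-1` [set r]) (e x)%:E.
    under eq_integral do rewrite EFinM -muleA.
    have [r0|r0] := leP 0%R r; last first.
      rewrite preimage_nnfun0// integral_set0 mule0; apply: integral0_eq => x _.
      by rewrite indic0 mul0e mule0.
    rewrite ge0_integralZl_EFin//; last 2 first.
    - by move=> x _; rewrite mule_ge0// lee_fin.
    - by apply: emeasurable_funM => //; apply/measurable_EFinP.
    congr (_ * _); rewrite [RHS]integral_mkcond; apply: eq_integral => x _.
    by rewrite patchE indicE; case: ifPn => _; rewrite ?mul1e ?mul0e.
  rewrite integralT_nnsfun sintegralE fsbig_finite//=.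
  transitivity (\sum_(r <- fset_set (range (g n))) \sum_i
      (k i)%:num%:E * \int[m i]_x ((r * \1_(g n @^-1` [set r]) x)%:E * (e x)%:E)).
    rewrite big_seq [RHS]big_seq; apply: eq_bigr => r.
    rewrite in_fset_set// inE => -[x _ gxr].
    rewrite muE// ge0_sume_distrr; last first.
      by move=> i _; apply: mule_ge0 => //; apply: integral_ge0 => y _;
        rewrite lee_fin.
    by apply: eq_bigr => i _; rewrite gre muleCA.
  rewrite exchange_big/=; apply: eq_bigr => i _.
  rewrite -ge0_sume_distrr; last first.
    move=> r _; apply: integral_ge0 => x _; apply: mule_ge0; rewrite lee_fin//.
    exact: nnfun_muleindic_ge0.
  congr (_ * _); under [RHS]eq_integral => x _.
    rewrite fimfunE -fsumEFin// ge0_mule_fsuml; last first.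
      by move=> r; rewrite lee_fin; exact: nnfun_muleindic_ge0.
    over.
  rewrite ge0_integral_fsum//; first by rewrite fsbig_finite.
  - move=> r; apply: emeasurable_funM => //; apply/measurable_EFinP.
    exact: measurable_funM.
  - move=> r x _; apply: mule_ge0; rewrite lee_fin//.
    exact: nnfun_muleindic_ge0.
have cvgl : \int[mu]_x (g n x)%:E @[n --> \oo] --> \int[mu]_x h x.
  rewrite (_ : \int[mu]_x h x = \int[mu]_x limn (fun n => (g n x)%:E)).
    by apply: cvg_monotone_convergence => // x _ a b; exact: ndg.
  by apply: eq_integral => x _; apply/esym/cvg_lim.
have cvgr i : \int[m i]_x ((g n x)%:E * (e x)%:E) @[n --> \oo] -->
    \int[m i]_x (h x * (e x)%:E).
  rewrite (_ : \int[m i]_x (h x * (e x)%:E) =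
      \int[m i]_x limn (fun n => (g n x)%:E * (e x)%:E)).
    apply: cvg_monotone_convergence => //.
    - by move=> n; exact: emeasurable_funM.
    - by move=> n x _; rewrite mule_ge0// lee_fin.
    - by move=> x _ a b /(ndg x) ab; rewrite lee_wpmul2r// lee_fin.
  apply: eq_integral => x _; apply/esym/cvg_lim => //.
  by apply: cvgeZr => //.
apply: (cvg_unique _ cvgl) => //.
rewrite (funext gE); apply: cvg_nnesum => [i _|i _].
  apply: nearW => n; rewrite mule_ge0//; apply: integral_ge0 => x _.
  by rewrite mule_ge0// lee_fin.
exact: cvgeZl.
Qed.

End lower_integral.

(** * Finite products of measures on the line *)

Section prod_measure_integral.
Context {R : realType}.
Local Open Scope ereal_scope.

(** Needed for Tonelli, since the type of [prod_measure] records only a measure. Rectangles with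
    head in [F k] and tail in [G k] exhaust the space: both sequences are nondecreasing, so the
    larger of two indices serves for head and tail together. *)
Lemma sigma_finite_prod_measure n
    (nu : 'I_n -> {sigma_finite_measure set (measurableTypeR R) -> \bar R}) :
  sigma_finite setT (prod_measure nu).
Proof.
elim: n nu => [|n IH] nu.
  apply: fin_num_fun_sigma_finite; first by rewrite measure0.
  by move=> A mA; exact: fin_num_measure.
have /sigma_finiteP[F [TF ndF Foo]] := sigma_finiteT (nu ord0).
have /sigma_finiteP[G [TG ndG Goo]] := IH (fun i => nu (lift ord0 i)).
pose tail (v : 'rV[R]_n.+1) : 'rV[R]_n := \row_i v ord0 (lift ord0 i).
have mtail : measurable_fun setT tail.
  apply/measurable_fun_rVP => i; under eq_fun do rewrite mxE.
  exact: measurable_rV_coord.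
have mhead : measurable_fun setT (fun v : 'rV[R]_n.+1 => v ord0 ord0).
  exact: measurable_rV_coord.
exists (fun k => (fun v : 'rV[R]_n.+1 => v ord0 ord0) @^-1` F k `&` tail @^-1` G k).
  apply/seteqP; split => // v _.
  have [i _ Fi] : (\bigcup_i F i) (v ord0 ord0) by rewrite -TF.
  have [j _ Gj] : (\bigcup_i G i) (tail v) by rewrite -TG.
  exists (maxn i j) => //; split.
    exact: ((elimT (subsetPset _ _) (ndF _ _ (leq_maxl i j))) _ Fi).
  exact: ((elimT (subsetPset _ _) (ndG _ _ (leq_maxr i j))) _ Gj).
move=> k; have [mF Flt] := Foo k; have [mG Glt] := Goo k; split.
  by apply: measurableI; rewrite -[X in measurable X]setTI;
    [exact: mhead|exact: mtail].
rewrite /= /cons_measure /pushforward.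
have -> : cons_rV @^-1` ((fun v : 'rV[R]_n.+1 => v ord0 ord0) @^-1` F k
    `&` tail @^-1` G k) = F k `*` G k.
  apply/seteqP; split => -[x v] /=; rewrite mxE unlift_none /= => -[Fx];
    rewrite (_ : tail _ = v)//; apply/rowP => i; by rewrite !mxE liftK.
by rewrite product_measure2E// lte_mul_pinfty// ge0_fin_numE.
Qed.

Lemma integral_prod_measure n
    (nu : 'I_n -> {sigma_finite_measure set (measurableTypeR R) -> \bar R})
    (f : 'I_n -> measurableTypeR R -> R) :
  (forall i, measurable_fun setT (f i)) -> (forall i x, (0 <= f i x)%R) ->
  \int[prod_measure nu]_v (\prod_i f i (v ord0 i))%:E =
  \prod_i \int[nu i]_x (f i x)%:E.
Proof.
elim: n nu f => [|n IH] nu f mf f0.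
  by rewrite big_ord0 /=; under eq_integral do rewrite big_ord0;
    rewrite integral_dirac//= diracT mul1e.
have mprod k (h : 'I_k -> measurableTypeR R -> R) :
    (forall i, measurable_fun setT (h i)) ->
    measurable_fun setT (fun v : 'rV[R]_k => \prod_i h i (v ord0 i))%R.
  move=> mh; apply: measurable_prod => i _.
  exact: (measurableT_comp (mh i) (measurable_rV_coord i)).
set m2 := prod_measure (fun i => nu (lift ord0 i)).
(* [m2] is repackaged as the sigma-finite measure [m2'], equal to it on all sets, so that the
   product-measure lemmas accept it. *)
pose H3 := isSigmaFinite.Build _ _ _ _
  (sigma_finite_prod_measure (fun i => nu (lift ord0 i))).
pose H2 := isSFinite.Build _ _ _ _ (sfinite_measure_sigma_finite
  (sigma_finite_prod_measure (fun i => nu (lift ord0 i)))).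
pose m2' := HB.pack_for (SigmaFiniteMeasure.type 'rV[R]_n R) (Measure.sort m2) H2 H3.
have m2E : m2 = m2' by exact: eq_measure.
rewrite big_ord_recl -IH//.
transitivity (\int[pushforward (nu ord0 \x^ m2) cons_rV]_v
   (\prod_i f i (v ord0 i))%:E) => //.
rewrite ge0_integral_pushforward//=; last 3 first.
- exact: measurable_cons_rV.
- by apply/measurable_EFinP; exact: mprod.
- by move=> v _; rewrite lee_fin prodr_ge0.
rewrite -/m2 m2E preimage_setT.
under eq_integral => p _.
  rewrite big_ord_recl mxE unlift_none; under eq_bigr do rewrite mxE liftK.
  over.
have mF : measurable_fun setT (fun p : measurableTypeR R * 'rV[R]_n =>
    (f ord0 p.1 * \prod_(i < n) f (lift ord0 i) (p.2 ord0 i))%:E).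
  apply/measurable_EFinP; apply: measurable_funM.
    exact: (measurableT_comp (mf ord0) measurable_fst).
  exact: (measurableT_comp (mprod n _ (fun i => mf (lift ord0 i))) measurable_snd).
(* [cons_measure] is built on [\x^], while the Tonelli step below is for [\x]; the two products
   agree on rectangles, hence on all measurable sets. *)
transitivity (\int[nu ord0 \x m2']_p
    (f ord0 p.1 * \prod_(i < n) f (lift ord0 i) (p.2 ord0 i))%:E).
  apply: eq_measure_integral => A mA _; apply/esym.
  apply: product_measure_unique => // B C mB mC. exact: product_measure2E.
rewrite fubini_tonelli1//=; last first.
  by move=> p; rewrite lee_fin mulr_ge0 ?prodr_ge0.
rewrite /fubini_F.
have FE x : \int[m2']_v (f ord0 x * \prod_(i < n) f (lift ord0 i) (v ord0 i))%:E =
    (f ord0 x)%:E * \int[m2']_v (\prod_(i < n) f (lift ord0 i) (v ord0 i))%:E.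
  under eq_integral do rewrite EFinM.
  rewrite ge0_integralZl_EFin//.
  - by move=> v _; rewrite lee_fin prodr_ge0.
  - by apply/measurable_EFinP; exact: (mprod n (fun i => f (lift ord0 i))).

under eq_integral do rewrite FE.
rewrite ge0_integralZr//.
- exact/measurable_EFinP.
- by move=> x _; rewrite lee_fin.
- by apply: integral_ge0 => v _; rewrite lee_fin prodr_ge0.
Qed.

End prod_measure_integral.

(** * Gauss-Laplace integrals *)

Section laplace_integrals.
Context {R : realType}.
Local Notation mu := (@lebesgue_measure R).

Lemma lebesgue_measure_translate (a : R) (A : set R) : measurable A ->
  pushforward mu (fun x : measurableTypeR R => x - a : measurableTypeR R) A = mu A.
Proof.
move=> mA; apply/esym/lebesgue_measure_unique => //=.
  exact: measurable_funB.
move=> mt _ [[u v]] _ <-.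
rewrite /pushforward (_ : _ @^-1` _ = `]u + a, v + a]%classic); last first.
  by apply/seteqP; split => x /=; rewrite !in_itv/= ltrBrDr lerBlDr.
by rewrite !lebesgue_measure_itv/= !lte_fin ltrD2r -!EFinB opprD addrACA subrr addr0.
Qed.

Lemma ge0_integral_translate (a : R) (h : R -> R) :
  measurable_fun setT h -> (forall x, 0 <= h x) ->
  (\int[mu]_x (h (x - a))%:E = \int[mu]_x (h x)%:E)%E.
Proof.
move=> mh h0.
pose t (x : measurableTypeR R) : measurableTypeR R := x - a.
have mt : measurable_fun setT t by exact: measurable_funB.
transitivity (\int[pushforward mu t]_x (h x)%:E)%E.
  rewrite ge0_integral_pushforward//; first exact/measurable_EFinP.
  by move=> y _; rewrite lee_fin.
by apply: eq_measure_integral => // A mA _; exact: lebesgue_measure_translate.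
Qed.

Lemma ge0_integral_opp (h : R -> R) :
  measurable_fun setT h -> (forall x, 0 <= h x) ->
  (\int[mu]_x (h (- x))%:E = \int[mu]_x (h x)%:E)%E.
Proof.
move=> mh h0.
pose t (x : measurableTypeR R) : measurableTypeR R := - x.
have mt : measurable_fun setT t by exact: measurableT_comp.
transitivity (\int[pushforward mu t]_x (h x)%:E)%E.
  rewrite ge0_integral_pushforward//; first exact/measurable_EFinP.
  by move=> y _; rewrite lee_fin.
by apply: eq_measure_integral => // A mA _; exact: lebesgue_measureN.
Qed.

(** An unnormalised Gaussian of precision [L] times a Laplace factor of rate [rho]: the former comes
    from the quadratic lower bound in [E1_hat], the latter from the prior. For [L = 0] it is the
    pure Laplace kernel used in the upper bounds. *)
Definition gl_kernel (L rho x : R) := expR (- (L / 2 * x ^+ 2 + rho * `|x|)).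

Lemma continuous_gl_kernel L rho : continuous (gl_kernel L rho).
Proof.
move=> x; rewrite /gl_kernel.
apply: continuous_comp; last exact: continuous_expR.
apply: cvgN; apply: cvgD.
  by apply: cvgMr; apply: exprn_continuous.
by apply: cvgMr; exact: norm_continuous.
Qed.

(* The integrand below is the derivative of
   [- exp (- (L x^2 / 2 + rho x)) / (L x + rho + L / rho)]; it lies between 0
   and the kernel, and equals it when [L = 0]. *)
Lemma integral_gl_minorant (L rho : R) : 0 <= L -> 0 < rho ->
  let c := L / rho in
  (\int[mu]_(x in `[0%R, +oo[)
     (gl_kernel L rho x * (((L * x + rho) ^+ 2 + (L * x + rho) * c + L) /
        (L * x + rho + c) ^+ 2))%:E = ((rho + c)^-1)%:E)%E.
Proof.
move=> L0 rho0 c.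
have c0 : 0 <= c by rewrite divr_ge0// ltW.
have D0 x : 0 <= x -> 0 < L * x + rho + c.
  by move=> x0; rewrite ltr_wpDr// ltr_wpDl// mulr_ge0.
pose K x := expR (- (L / 2 * x ^+ 2 + rho * x)).
pose f x := K x * (((L * x + rho) ^+ 2 + (L * x + rho) * c + L) /
        (L * x + rho + c) ^+ 2).
pose F x := - (K x / (L * x + rho + c)).
have dF (x : R) : 0 <= x -> is_derive x 1 F (f x).
  move=> x0.
  have Dx := lt0r_neq0 (D0 _ x0).
  have dS : is_derive x 1 (fun y => L * y + rho + c) L.
    rewrite (_ : (fun y => _) = (L \*: id + cst (rho + c))); last first.
      by apply/funext => y; rewrite fctE addrA.
    by apply: is_derive_eq; rewrite addr0 [_ *: _]mulr1.
  have dE : is_derive x 1 (fun y => - (L / 2 * y ^+ 2 + rho * y)) (- (L * x + rho)).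
    rewrite (_ : (fun y => _) = - ((L / 2) \*: id ^+ 2 + rho \*: id)); last first.
      by apply/funext => y; rewrite !fctE.
    by apply: is_derive_eq; rewrite /= /GRing.scale/= expr1; field.
  have dK : is_derive x 1 K (K x * - (L * x + rho)).
    exact: (@is_derive1_comp _ expR (fun y => - (L / 2 * y ^+ 2 + rho * y)) x _ _ _ dE).
  have dV := @is_deriveV _ (fun y => L * y + rho + c) x _ _ Dx dS.
  rewrite (_ : F = - (K * (fun y => (L * y + rho + c)^-1)))//.
  apply: is_derive_eq; rewrite /f /GRing.scale/= /c; field.
  rewrite (lt0r_neq0 rho0) (_ : _ + L = rho * (L * x + rho + c)).
    by rewrite mulf_neq0// lt0r_neq0.
  by rewrite /c; field; exact: lt0r_neq0.
have FE : {in `]0, +oo[, F^`()%classic =1 f}.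
  move=> x; rewrite in_itv/= andbT => x0.
  by rewrite derive1E; have [_ ->] := dF x (ltW x0).
have f0 x : 0 <= x -> 0 <= f x.
  move=> x0; rewrite mulr_ge0 ?expR_ge0// divr_ge0 ?sqr_ge0//.
  have s0 : 0 <= L * x + rho by rewrite addr_ge0 ?mulr_ge0// ltW.
  by apply: addr_ge0 => //; apply: addr_ge0; [exact: sqr_ge0|exact: mulr_ge0].
transitivity (\int[mu]_(x in `[0%R, +oo[) (f x)%:E)%E.
  apply: eq_integral => x; rewrite inE/= in_itv/= andbT => x0.
  by rewrite /f /K /gl_kernel ger0_norm.
have cf : {within `[0, +oo[, continuous f}.
  apply: continuous_in_subspaceT => x; rewrite inE/= in_itv/= andbT => x0.
  have cD : {for x, continuous (fun y => L * y + rho)}.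
    by apply: cvgD; [apply: cvgMr; exact: cvg_id|exact: cvg_cst].
  have cDc : {for x, continuous (fun y => L * y + rho + c)}.
    by apply: cvgD; [exact: cD|exact: cvg_cst].
  apply: cvgM; last apply: cvgM.
  - apply: continuous_comp; last exact: continuous_expR.
    apply: cvgN; apply: cvgD; last by apply: cvgMr; exact: cvg_id.
    by apply: cvgMr; exact: exprn_continuous.
  - apply: cvgD; last exact: cvg_cst.
    by apply: cvgD; [exact: (cvg_comp _ _ cD (@exprn_continuous _ 2 _))|
      apply: cvgMl; exact: cD].
  - apply: cvgV; first by rewrite expf_neq0// lt0r_neq0// D0.
    exact: (cvg_comp _ _ cDc (@exprn_continuous _ 2 _)).
have Fy : F x @[x --> +oo] --> 0.
  apply: norm_cvg0.
  apply: (@squeeze_cvgr _ _ _ _ (cst 0) (fun x => rho^-1 * expR (- (rho * x)))).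
  - near=> x; have x0 : 0 <= x by near: x; exact: nbhs_pinfty_ge.
    rewrite normr_ge0/= /F normrN normrM normfV ger0_norm ?expR_ge0//.
    rewrite (gtr0_norm (D0 _ x0)) mulrC ler_pM ?expR_ge0//.
    + by rewrite invr_ge0 ltW// D0.
    + by rewrite lef_pV2 ?posrE ?D0// addrAC lerDr addr_ge0// mulr_ge0.
    + by rewrite ler_expR lerN2 lerDr mulr_ge0 ?sqr_ge0// divr_ge0.
  - exact: cvg_cst.
  - rewrite -[0](mulr0 rho^-1); apply: cvgMr.
    apply: (@cvg_comp _ _ _ (fun x => rho * x) (fun x => expR (- x)) _
      (pinfty_nbhs R)); last exact: cvgr_expR.
    exact: gt0_cvgMry.
have F0 : F x @[x --> 0^'+] --> F 0.
  apply: cvg_at_right_filter; apply: differentiable_continuous.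
  by apply/derivable1_diffP; have [] := dF 0 (lexx _).
have dFx x : 0 < x -> derivable F x 1.
  by move=> x0; have [] := dF x (ltW x0).
rewrite (ge0_continuous_FTC2y f0 cf Fy dFx F0 FE) sub0e -EFinN; congr EFin.
rewrite /F /K opprK mulr0 expr0n/= mulr0 mulr0 add0r oppr0 expR0 div1r.
by rewrite add0r.
Unshelve. all: by end_near. Qed.

Lemma gl_kernel_ge0 L rho x : 0 <= gl_kernel L rho x.
Proof. exact: expR_ge0. Qed.

Lemma measurable_gl_kernel L rho : measurable_fun setT (gl_kernel L rho).
Proof. by apply: continuous_measurable_fun; exact: continuous_gl_kernel. Qed.

Lemma integral_gl_kernelE L rho :
  (\int[mu]_x (gl_kernel L rho x)%:E =
   2%:E * \int[mu]_(x in `[0%R, +oo[) (gl_kernel L rho x)%:E)%E.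
Proof.
rewrite set_itvcy ge0_symfun_integralT//.
- by move=> x; exact: gl_kernel_ge0.
- exact: continuous_gl_kernel.
- by move=> x; rewrite /gl_kernel/= sqrrN normrN.
Qed.

(** A Mills-ratio bound on each half-line. With s = L x + rho and c = L / rho, the minorant lies
    below the kernel as soon as L <= s c + c^2, which follows from L = rho c and rho <= s. *)
Lemma integral_gl_kernel_ge (L rho : R) : 0 <= L -> 0 < rho ->
  ((2 / (rho + L / rho))%:E <= \int[mu]_x (gl_kernel L rho x)%:E)%E.
Proof.
move=> L0 rho0; rewrite integral_gl_kernelE EFinM lee_pmul2l//.
rewrite -integral_gl_minorant//; apply: ge0_le_lower_integral => x /=;
  rewrite in_itv/= andbT => x0; have c0 : 0 <= L / rho by rewrite divr_ge0// ltW.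
- have s0 : 0 <= L * x + rho by rewrite addr_ge0 ?mulr_ge0// ltW.
  rewrite lee_fin mulr_ge0 ?gl_kernel_ge0// divr_ge0 ?sqr_ge0//.
  by apply: addr_ge0 => //; apply: addr_ge0; [exact: sqr_ge0|exact: mulr_ge0].
- have s0 : rho <= L * x + rho by rewrite lerDr mulr_ge0.
  rewrite lee_fin ler_piMr ?gl_kernel_ge0//.
  rewrite ler_pdivrMr ?mul1r; last by rewrite exprn_gt0// ltr_wpDr// (lt_le_trans rho0).
  have Lc : L = rho * (L / rho) by field; exact: lt0r_neq0.
  move: s0 Lc c0; set s := L * x + rho; set c := L / rho => s0 Lc c0.
  have : rho * c <= s * c by rewrite ler_wpM2r.
  have : 0 <= c ^+ 2 by rewrite sqr_ge0.
  by rewrite -Lc !expr2 => ? ?; nra.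
Qed.

Lemma integral_laplace_kernel (rho : R) : 0 < rho ->
  (\int[mu]_x (gl_kernel 0 rho x)%:E = (2 / rho)%:E)%E.
Proof.
move=> rho0; rewrite integral_gl_kernelE EFinM; congr (_ * _)%E.
have := integral_gl_minorant (lexx 0) rho0; rewrite /= mul0r addr0 => <-.
apply: eq_integral => x _; rewrite !(mul0r, mulr0, add0r, addr0).
by rewrite divff ?mulr1// expf_neq0// lt0r_neq0.
Qed.

(* Averaging over [x] and [- x] turns the tilt into [cosh (G x) >= 1]. *)
Lemma integral_tilted_gl_kernel_ge (L rho G : R) : 0 <= L -> 0 < rho ->
  ((2 / (rho + L / rho))%:E <=
     \int[mu]_x (expR (G * x) * gl_kernel L rho x)%:E)%E.
Proof.
move=> L0 rho0; apply: (le_trans (integral_gl_kernel_ge L0 rho0)).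
pose h x := expR (G * x) * gl_kernel L rho x.
have h0 x : 0 <= h x by rewrite mulr_ge0 ?expR_ge0 ?gl_kernel_ge0.
have mh : measurable_fun setT h.
  apply: measurable_funM; last exact: measurable_gl_kernel.
  by apply: measurableT_comp => //; exact: measurable_funM.
have mhN : measurable_fun setT (h \o -%R) by exact: measurableT_comp.
rewrite -/h.
have E : (2%:E * \int[mu]_x (h x)%:E = \int[mu]_x (h x + h (- x))%:E)%E.
  under [RHS]eq_integral do rewrite EFinD.
  rewrite ge0_integralD//; last 4 first.
  - by move=> x _; rewrite lee_fin.
  - exact/measurable_EFinP.
  - by move=> x _; rewrite lee_fin.
  - exact/measurable_EFinP.
  by rewrite ge0_integral_opp// mule_natl mule2n.
rewrite -(@lee_pmul2l _ 2%:E)// E -ge0_integralZl_EFin//; last 2 first.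
- by move=> x _; rewrite lee_fin gl_kernel_ge0.
- by apply/measurable_EFinP; exact: measurable_gl_kernel.
apply: ge0_le_lower_integral => x _.
  by rewrite mule_ge0// lee_fin gl_kernel_ge0.
have glN : gl_kernel L rho (- x) = gl_kernel L rho x.
  by rewrite /gl_kernel sqrrN normrN.
rewrite -EFinM lee_fin /h glN -mulrDl.
rewrite ler_wpM2r ?gl_kernel_ge0// mulrN expRN.
have := expR_gt0 (G * x); set e := expR _ => e0.
rewrite -(ler_pM2r e0) [leRHS]mulrDl mulVf ?lt0r_neq0//.
by have := sqr_ge0 (e - 1); nra.
Qed.

End laplace_integrals.

(** * Integration against the spike-and-slab prior *)

Section ereal_products.
Context {R : realType} {I : finType}.
Implicit Types (F : I -> \bar R) (g : I -> R).

Lemma prode_le_EFin F g : (forall i, 0 <= F i)%E -> (forall i, F i <= (g i)%:E)%E ->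
  (\prod_i F i <= (\prod_i g i)%:E)%E.
Proof.
move=> F0 Fg; pose le0 (x : \bar R) (y : R) := (0 <= x)%E /\ (x <= y%:E)%E.
suff [] : le0 (\prod_i F i)%E (\prod_i g i) by [].
apply: (big_rec2 le0) => [|i y x _ [x0 xy]]; first by rewrite /le0 !lee_fin.
by split; [exact: mule_ge0|rewrite EFinM lee_pmul].
Qed.

Lemma prode_ge_EFin F g : (forall i, 0 <= g i) -> (forall i, (g i)%:E <= F i)%E ->
  ((\prod_i g i)%:E <= \prod_i F i)%E.
Proof.
move=> g0 gF; pose ge0 (x : \bar R) (y : R) := 0 <= y /\ (y%:E <= x)%E.
suff [] : ge0 (\prod_i F i)%E (\prod_i g i) by [].
apply: (big_rec2 ge0) => [|i y x _ [x0 xy]]; first by rewrite /ge0 !lee_fin.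
by split; [exact: mulr_ge0|rewrite EFinM lee_pmul// lee_fin].
Qed.

End ereal_products.

Section spike_and_slab_prior.
Context {R : realType} {d : nat}.
Implicit Types (theta a : 'rV[R]_d) (delta : {ffun 'I_d -> bool}).
Variables (w : {ffun 'I_d -> bool} -> {nonneg R}) (rho : {posnum R}).

Lemma integral_prior (h : 'rV[R]_d -> \bar R) :
  measurable_fun setT h -> (forall theta, 0 <= h theta)%E ->
  (\int[prior w rho]_theta h theta =
   \sum_delta ((w delta)%:num * (rho%:num / 2) ^+ model_size delta)%:E *
     \int[model_measure delta]_theta
       (h theta * (expR (- (rho%:num * l1 theta)))%:E))%E.
Proof.
move=> mh h0.
have k0 delta : 0 <= (w delta)%:num * (rho%:num / 2) ^+ model_size delta by [].
apply: (@ge0_integral_density _ _ _ (prior w rho) _ model_measure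
  (fun delta => NngNum (k0 delta))) => //.
apply: measurableT_comp => //; apply: measurableT_comp => //.
by apply: measurable_funM => //; exact: measurable_l1.
Qed.

Lemma measurable_l0_ge m : measurable [set theta : 'rV[R]_d | (m <= l0 theta)%N].
Proof.
have mf : measurable_fun setT (fun theta : 'rV[R]_d =>
    \sum_j \1_(~` [set (0 : R)]) (theta ord0 j) : R).
  apply: measurable_sum => j.
  apply: (measurableT_comp _ (measurable_rV_coord j)).
  by apply: measurable_indic; exact: measurableC.
rewrite (_ : [set _ | _] = (fun theta : 'rV[R]_d =>
    \sum_j \1_(~` [set (0 : R)]) (theta ord0 j) : R) @^-1` `[m%:R, +oo[).
  by rewrite -[X in measurable X]setTI; exact: mf.
have sumE theta : \sum_j \1_(~` [set (0 : R)]) (theta ord0 j) = (l0 theta)%:R :> R.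
  rewrite /l0 -sum1_card natr_sum [RHS]big_mkcond/=; apply: eq_bigr => j _.
  rewrite indicE in_setC !inE; case: eqP => [->|/eqP x0].
    by rewrite mem_set.
  by rewrite memNset//; exact/eqP.
by apply/seteqP; split => theta /=; rewrite in_itv/= andbT sumE ler_nat.
Qed.

Lemma integral_spike (h : R -> R) : measurable_fun setT h ->
  (\int[@spike_slab R false]_x (h x)%:E = (h 0)%:E)%E.
Proof.
by move=> mh; rewrite integral_dirac ?diracT ?mul1e//; exact/measurable_EFinP.
Qed.

Lemma measurable_shift_gl_kernel (L r b : R) :
  measurable_fun setT (fun x : R => gl_kernel L r (x - b)).
Proof.
by apply: (measurableT_comp (measurable_gl_kernel L r)); exact: measurable_funB.
Qed.

(** A slab coordinate integrates the Laplace kernel to 2 / kappa and a spike coordinate contributes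
    at most 1. A model with fewer than [m] active coordinates contributes nothing, because its
    measure does not charge the vectors with at least [m] nonzero entries. *)
Lemma integral_model_le (a : 'rV[R]_d) (kappa : R) m delta : 0 < kappa ->
  (\int[model_measure delta]_theta
     (\1_[set theta : 'rV[R]_d | (m <= l0 theta)%N] theta *
      expR (- (kappa * l1 (theta - a))))%:E <=
   ((m <= model_size delta)%:R * (2 / kappa) ^+ model_size delta)%:E)%E.
Proof.
move=> k0.
have expE theta : expR (- (kappa * l1 (theta - a))) =
    \prod_j gl_kernel 0 kappa (theta ord0 j - a ord0 j).
  rewrite /gl_kernel -expR_sum; congr expR.
  rewrite sumrN mulr_sumr; congr (- _); apply: eq_bigr => j _.
  by rewrite mul0r mul0r add0r !mxE.
have gl0 x : 0 <= gl_kernel 0 kappa x by exact: gl_kernel_ge0.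
have int1 j : (\int[spike_slab (delta j)]_x
    (gl_kernel 0 kappa (x - a ord0 j))%:E <= (if delta j then 2 / kappa else 1)%:E)%E.
  case: (delta j).
    rewrite (@ge0_integral_translate _ (a ord0 j) (gl_kernel 0 kappa))//.
      by rewrite integral_laplace_kernel.
    exact: measurable_gl_kernel.
  rewrite integral_spike; last exact: measurable_shift_gl_kernel.
  by rewrite lee_fin -expR0 ler_expR mul0r mul0r add0r oppr_le0 mulr_ge0// ltW.
have [md|dm] := leqP m (model_size delta).
  rewrite mul1r.
  apply: (@le_trans _ _ (\int[model_measure delta]_theta
      (\prod_j gl_kernel 0 kappa (theta ord0 j - a ord0 j))%:E)%E).
    apply: ge0_le_lower_integral => theta _; rewrite lee_fin.
      by rewrite mulr_ge0 ?expR_ge0.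
    by rewrite expE ler_piMl ?prodr_ge0// indicE lern1 leq_b1.
  rewrite (integral_prod_measure (fun j => spike_slab (delta j))
    (f := fun j x => gl_kernel 0 kappa (x - a ord0 j)))//; last first.
    by move=> j; exact: measurable_shift_gl_kernel.
  apply: le_trans (prode_le_EFin _ int1) _ => [j|].
    by apply: integral_ge0 => x _; rewrite lee_fin.
  by rewrite -big_mkcond/= prodr_const lexx.
rewrite mul0r.
(* If theta has more nonzero entries than the model has slabs, some spike coordinate j is nonzero.
   So the integrand is at most the sum of the [H j], where [H j] carries the indicator of a nonzero
   j-th entry, and each [H j] integrates to 0 against the Dirac mass at 0. *)
pose h j i x := gl_kernel 0 kappa (x - a ord0 i) *
  (if i == j then \1_(~` [set (0 : R)]) x else 1).
have mN0 : measurable (~` [set (0 : R)]) by exact: measurableC.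
have h0 j i x : 0 <= h j i x by rewrite mulr_ge0//; case: (i == j).
have mh j i : measurable_fun setT (h j i).
  apply: measurable_funM; first exact: measurable_shift_gl_kernel.
  by case: (i == j); [exact: measurable_indic|exact: measurable_cst].
pose H j theta := if delta j then 0 else \prod_i h j i (theta ord0 i).
have H0 j theta : 0 <= H j theta by rewrite /H; case: (delta j); rewrite ?prodr_ge0.
have mH j : measurable_fun setT (H j).
  rewrite /H; case: (delta j); first exact: measurable_cst.
  apply: measurable_prod => i _.
  exact: (measurableT_comp (mh j i) (measurable_rV_coord i)).
apply: (@le_trans _ _ (\int[model_measure delta]_theta (\sum_j (H j theta)%:E))%E).
  apply: ge0_le_lower_integral => theta _.
    by rewrite lee_fin mulr_ge0 ?expR_ge0.
  rewrite sumEFin lee_fin indicE; case: (boolP (theta \in _)) => [|_]; last first.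
    by rewrite mul0r sumr_ge0.
  rewrite inE/= mul1r => ml.
  have [j [dj tj]] : exists j, ~~ delta j /\ theta ord0 j != 0.
    apply: contrapT => K.
    suff : (l0 theta <= model_size delta)%N by rewrite leqNgt (leq_trans dm).
    apply: subset_leq_card; apply/fintype.subsetP => j; rewrite !inE => tj.
    by apply/negPn/negP => dj; apply: K; exists j.
  rewrite (bigD1 j)//= -[leLHS]addr0 lerD ?sumr_ge0//.
  rewrite /H (negPf dj) expE big_split/=.
  rewrite [X in _ <= _ * X](_ : _ = 1) ?mulr1//.
  rewrite (bigD1 j)//= eqxx indicE mem_set ?mul1r; last exact: (elimN eqP tj).
  by apply: big1 => i /negPf ->.
rewrite ge0_integral_sum//; last 2 first.
- by move=> j; apply/measurable_EFinP.
- by move=> j theta _; rewrite lee_fin.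
rewrite big1// => j _; rewrite /H; case: (boolP (delta j)) => dj.
  by rewrite integral0.
rewrite (integral_prod_measure (fun j => spike_slab (delta j)))//; last exact: mh.
rewrite (bigD1 j)//= (negPf dj) integral_spike// /h eqxx indicE.
by rewrite memNset ?mulr0 ?mul0e//=; exact.
Qed.

Lemma model_size_delta_star a : model_size (delta_star a) = l0 a.
Proof. by apply: eq_card => j; rewrite !inE ffunE. Qed.

(** The integrand is a product over coordinates, so the tilt [G] is removed one coordinate at a time
    by [integral_tilted_gl_kernel_ge]. The indicator of 0 costs nothing on a spike and confines the
    minorant to the support of [a]. *)
Lemma integral_model_star_ge (a : 'rV[R]_d) (L kappa : R) (G : 'rV[R]_d) :
  0 <= L -> 0 < kappa ->
  (((2 / (kappa + L / kappa)) ^+ l0 a)%:E <=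
   \int[model_measure (delta_star a)]_theta
     (\prod_j (if delta_star a j then
        expR (G ord0 j * (theta ord0 j - a ord0 j)) *
          gl_kernel L kappa (theta ord0 j - a ord0 j)
      else \1_[set (0 : R)] (theta ord0 j)))%:E)%E.
Proof.
move=> L0 k0.
pose h j (x : R) := if delta_star a j then
    expR (G ord0 j * (x - a ord0 j)) * gl_kernel L kappa (x - a ord0 j)
  else \1_[set (0 : R)] x.
have h0 j x : 0 <= h j x.
  by rewrite /h; case: (delta_star a j); rewrite ?mulr_ge0 ?expR_ge0.
pose t j (x : R) := expR (G ord0 j * x) * gl_kernel L kappa x.
have mt j : measurable_fun setT (t j).
  apply: measurable_funM; last exact: measurable_gl_kernel.
  by apply: measurableT_comp => //; exact: measurable_funM.
have mh j : measurable_fun setT (h j).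
  rewrite /h; case: (delta_star a j); last exact: measurable_indic.
  by apply: (measurableT_comp (mt j)); exact: measurable_funB.
rewrite (integral_prod_measure (fun j => spike_slab (delta_star a j)) (f := h))//.
have -> : (2 / (kappa + L / kappa)) ^+ l0 a =
    \prod_j (if delta_star a j then 2 / (kappa + L / kappa) else 1).
  by rewrite -big_mkcond/= prodr_const -model_size_delta_star.
apply: prode_ge_EFin => j.
  by case: (delta_star a j) => //; rewrite divr_ge0 ?addr_ge0 ?divr_ge0// ltW.
rewrite /h; case: (delta_star a j).
  rewrite (@ge0_integral_translate _ (a ord0 j) (t j))//; last first.
    by move=> x; rewrite mulr_ge0 ?expR_ge0.
  exact: integral_tilted_gl_kernel_ge.
rewrite integral_spike; last exact: measurable_indic.
by rewrite indicE mem_set.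
Qed.

(** [A] may be nonmeasurable, so the majorant [h] only remembers the measurable constraint on [l0].
    The factor exp (rho |theta|_1) cancels the prior density and leaves a Laplace kernel of rate
    kappa centred at [a]; each active coordinate then gives (rho / 2) (2 / kappa) = rho / kappa. *)
Lemma prior_integral_le (a : 'rV[R]_d) (A : set 'rV[R]_d) (F : 'rV[R]_d -> R)
    (K kappa : R) m : 0 <= K -> 0 < kappa ->
  (forall theta, A theta -> 0 <= F theta) ->
  (forall theta, A theta -> (m <= l0 theta)%N) ->
  (forall theta, A theta -> F theta <= K *
     expR (rho%:num * l1 theta - rho%:num * l1 a - kappa * l1 (theta - a))) ->
  (\int[prior w rho]_(theta in A) (F theta)%:E <=
   (K * expR (- (rho%:num * l1 a)) * \sum_(delta | (m <= model_size delta)%N)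
      (w delta)%:num * (rho%:num / kappa) ^+ model_size delta)%:E)%E.
Proof.
move=> K0 k0 F0 Am FK.
pose h theta := K * expR (- (rho%:num * l1 a)) * (
  \1_[set theta : 'rV[R]_d | (m <= l0 theta)%N] theta *
  expR (- (kappa * l1 (theta - a)))) * expR (rho%:num * l1 theta).
have h0 theta : 0 <= h theta by rewrite !mulr_ge0 ?expR_ge0.
have ml1a : measurable_fun setT (fun theta : 'rV[R]_d => l1 (theta - a)).
  apply: measurable_sum => j; apply: measurableT_comp => //.
  under eq_fun do rewrite !mxE.
  by apply: measurable_funB => //; exact: measurable_rV_coord.
have mi : measurable_fun setT (fun theta : 'rV[R]_d =>
  \1_[set theta : 'rV[R]_d | (m <= l0 theta)%N] theta *
  expR (- (kappa * l1 (theta - a)))).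
  apply: measurable_funM; first by apply: measurable_indic; exact: measurable_l0_ge.
  apply: measurableT_comp => //; apply: measurableT_comp => //.
  exact: measurable_funM.
have mh : measurable_fun setT h.
  apply: measurable_funM; first exact: measurable_funM.
  apply: measurableT_comp => //; apply: measurable_funM => //.
  exact: measurable_l1.
apply: (@le_trans _ _ (\int[prior w rho]_theta (h theta)%:E)%E).
  rewrite [leLHS]integral_mkcond; apply: ge0_le_lower_integral => theta _.
    by apply: erestrict_ge0 => // x Ax; rewrite lee_fin; exact: F0.
  rewrite patchE; case: ifPn => [|_]; rewrite lee_fin// inE => At.
  apply: (le_trans (FK _ At)); rewrite /h indicE mem_set//=; last exact: Am.
  rewrite mul1r -!mulrA ler_wpM2l// -!expRD ler_expR.
  by rewrite le_eqVlt; apply/orP; left; apply/eqP; ring.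
rewrite integral_prior//; last exact/measurable_EFinP.
rewrite [X in (_ * X)%:E]big_mkcond/= mulr_sumr -sumEFin; apply: lee_sum => delta _.
have hE theta : h theta * expR (- (rho%:num * l1 theta)) =
    K * expR (- (rho%:num * l1 a)) * (
      \1_[set theta : 'rV[R]_d | (m <= l0 theta)%N] theta *
      expR (- (kappa * l1 (theta - a)))).
  by rewrite /h -[LHS]mulrA -expRD subrr expR0 mulr1.
under eq_integral do rewrite -EFinM hE EFinM.
rewrite ge0_integralZl_EFin//; last 2 first.
- exact/measurable_EFinP.
- by rewrite mulr_ge0 ?expR_ge0.
rewrite muleA -EFinM.
apply: (le_trans (lee_wpmul2l _ (integral_model_le a m delta k0))).
  by rewrite lee_fin !mulr_ge0 ?expR_ge0.
rewrite -EFinM lee_fin; case: (m <= _)%N; last by rewrite !(mul0r, mulr0).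
rewrite mul1r; have -> : rho%:num / kappa = rho%:num / 2 * (2 / kappa).
  by field; exact: lt0r_neq0.
rewrite [in leRHS]exprMn; move: (_ ^+ _) (_ ^+ _) => x y.
by rewrite le_eqVlt; apply/orP; left; apply/eqP; ring.
Qed.

(** Only the model of [a] is kept. There |theta|_1 <= |a|_1 + |theta - a|_1 recentres the Laplace
    factor at [a], so the minorant splits over coordinates, and each active one contributes (rho /
    2) * 2 / (rho + L / rho) = 1 / (1 + L / rho^2). *)
Lemma prior_integral_ge (a : 'rV[R]_d) (F : 'rV[R]_d -> R)
    (K L : R) (G : 'rV[R]_d) : 0 <= K -> 0 <= L ->
  measurable_fun setT F -> (forall theta, 0 <= F theta) ->
  (forall theta, (forall j, a ord0 j = 0 -> theta ord0 j = 0) ->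
     K * expR (dot G (theta - a) - L / 2 * l2 (theta - a) ^+ 2) <= F theta) ->
  ((K * expR (- (rho%:num * l1 a)) *
     ((w (delta_star a))%:num / (1 + L / rho%:num ^+ 2) ^+ l0 a))%:E <=
   \int[prior w rho]_theta (F theta)%:E)%E.
Proof.
move=> K0 L0 mF F0 KF.
rewrite integral_prior//; last exact/measurable_EFinP.
rewrite (bigD1 (delta_star a))//= -[leLHS]adde0 leeD//; last first.
  apply: sume_ge0 => delta _; apply: mule_ge0; first by rewrite lee_fin.
  by apply: integral_ge0 => theta _; rewrite mule_ge0// lee_fin.
pose h (theta : 'rV[R]_d) := \prod_j (if delta_star a j then
        expR (G ord0 j * (theta ord0 j - a ord0 j)) *
          gl_kernel L rho%:num (theta ord0 j - a ord0 j)
      else \1_[set (0 : R)] (theta ord0 j)).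
have h0 theta : 0 <= h theta.
  by apply: prodr_ge0 => j _; case: (delta_star a j); rewrite ?mulr_ge0 ?expR_ge0.
have mh : measurable_fun setT h.
  apply: measurable_prod => j _; case: (delta_star a j); last first.
    apply: (measurableT_comp _ (measurable_rV_coord j)).
    exact: measurable_indic.
  have mj : measurable_fun setT (fun theta : 'rV[R]_d => theta ord0 j - a ord0 j).
    by apply: measurable_funB => //; exact: measurable_rV_coord.
  apply: measurable_funM.
    by apply: measurableT_comp => //; exact: measurable_funM.
  exact: (measurableT_comp (measurable_gl_kernel L rho%:num) mj).
have hF theta : K * expR (- (rho%:num * l1 a)) * h theta <=
    F theta * expR (- (rho%:num * l1 theta)).
  have [supp|nsupp] := pselect (forall j, a ord0 j = 0 -> theta ord0 j = 0); last first.
    have [j [aj tj]] : exists j, a ord0 j = 0 /\ theta ord0 j != 0.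
      apply: contrapT => N; apply: nsupp => j aj; apply/eqP/negPn/negP => tj.
      by apply: N; exists j.
    rewrite /h (bigD1 j)//= ffunE aj eqxx/= indicE memNset/=; last exact/eqP.
    by rewrite mul0r mulr0 mulr_ge0 ?expR_ge0.
  have -> : h theta = expR (dot G (theta - a) - L / 2 * l2 (theta - a) ^+ 2 -
      rho%:num * l1 (theta - a)).
    rewrite /dot /l2 /l1 sqr_sqrtr ?sumr_ge0// => [|j _]; last exact: sqr_ge0.
    rewrite !mulr_sumr -!sumrB expR_sum; apply: eq_bigr => j _.
    rewrite ffunE !mxE; case: eqP => [aj|_].
      by rewrite aj (supp _ aj) subrr normr0 expr0n/= !mulr0 !subr0 expR0 indicE mem_set.
    by rewrite /= /gl_kernel -expRD opprD addrA.
  apply: (@le_trans _ _ (K * expR (dot G (theta - a) - L / 2 * l2 (theta - a) ^+ 2) *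
     expR (- (rho%:num * l1 theta)))); last by rewrite ler_wpM2r ?expR_ge0// KF.
  rewrite -!mulrA ler_wpM2l// -!expRD ler_expR addrC -addrA lerD2l -opprD lerN2 -mulrDr.
  rewrite ler_pM2l// -big_split/=; apply: ler_sum => j _.
  rewrite !mxE -[leLHS]/`|theta ord0 j|.
  by rewrite -[in leLHS](subrK (a ord0 j) (theta ord0 j)) ler_normD.
apply: (@le_trans _ _ (
    ((w (delta_star a))%:num * (rho%:num / 2) ^+ model_size (delta_star a))%:E *
    \int[model_measure (delta_star a)]_theta
      (K * expR (- (rho%:num * l1 a)) * h theta)%:E)%E).
  under eq_integral do rewrite EFinM.
  rewrite ge0_integralZl_EFin//; last 3 first.
  - by move=> theta _; rewrite lee_fin.
  - exact/measurable_EFinP.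
  - by rewrite mulr_ge0 ?expR_ge0.
  rewrite muleA.
  apply: (le_trans _ (lee_wpmul2l _
    (integral_model_star_ge a G L0 (gt0 rho)))); last first.
    by rewrite lee_fin !mulr_ge0 ?expR_ge0.
  rewrite -!EFinM lee_fin model_size_delta_star.
  have -> : 1 + L / rho%:num ^+ 2 = (rho%:num / 2 * (2 / (rho%:num + L / rho%:num)))^-1.
    have : rho%:num + L / rho%:num != 0 by rewrite lt0r_neq0// ltr_wpDr// divr_ge0.
    move=> r0; field; rewrite lt0r_neq0//=.
    have -> : rho%:num * rho%:num + L = rho%:num * (rho%:num + L / rho%:num).
      by field; exact: lt0r_neq0.
    by rewrite mulf_neq0// lt0r_neq0.
  rewrite exprVn invrK exprMn; move: ((_ / _) ^+ _) ((_ / _) ^+ _) => x y.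
  by rewrite le_eqVlt; apply/orP; left; apply/eqP; ring.
apply: lee_wpmul2l; first by rewrite lee_fin.
apply: ge0_le_lower_integral => theta _.
  by rewrite lee_fin !mulr_ge0 ?expR_ge0.
by rewrite -EFinM lee_fin.
Qed.

End spike_and_slab_prior.

(** * Model weights *)

Section model_weights.
Context {R : realType} {d : nat}.
Implicit Types delta : {ffun 'I_d -> bool}.
Variables (w : {ffun 'I_d -> bool} -> {nonneg R}) (g : nat -> R) (U V : R).
Hypothesis g_ge0 : forall s, (s <= d)%N -> 0 <= g s.
Hypothesis g_sum : \sum_(s < d.+1) g s = 1.
Hypothesis w_g : forall delta, (w delta)%:num =
  g (model_size delta) * ('C(d, model_size delta)%:R)^-1.
Hypothesis U_gt0 : 0 < U.
Hypothesis V_gt0 : 0 < V.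
Hypothesis g_le : forall s, (1 <= s <= d)%N -> g s <= U * g s.-1.
Hypothesis g_ge : forall s, (1 <= s <= d)%N -> g s.-1 <= V * g s.

Lemma g_le_expU s k : (s + k <= d)%N -> g (s + k) <= U ^+ k * g s.
Proof.
elim: k => [|k IH] skd; first by rewrite addn0 expr0 mul1r.
rewrite addnS in skd *; apply: (le_trans (g_le _)); first by rewrite skd.
by rewrite exprS -mulrA ler_pM2l// IH// ltnW.
Qed.

Lemma g0_le_expV s : (s <= d)%N -> g 0 <= V ^+ s * g s.
Proof.
elim: s => [|s IH] sd; first by rewrite expr0 mul1r.
apply: (le_trans (IH (ltnW sd))); rewrite exprSr -mulrA ler_pM2l ?exprn_gt0//.
exact: (@g_ge s.+1).
Qed.

(** A zero would spread: downwards to [g 0] by the lower ratio bound, then upwards to all sizes by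
    the upper one, against total mass 1. Positivity is required because the weight of the true model
    ends up in a denominator. *)
Lemma g_gt0 s : (s <= d)%N -> 0 < g s.
Proof.
move=> sd; rewrite lt0r g_ge0// andbT; apply/eqP => gs0.
have g00 : g 0 = 0.
  by apply/eqP; rewrite eq_le g_ge0// andbT (le_trans (g0_le_expV sd))// gs0 mulr0.
have : \sum_(j < d.+1) g j <= 0.
  apply: sumr_le0 => j _; have := @g_le_expU 0 j.
  by rewrite add0n g00 mulr0 -ltnS; apply.
by rewrite g_sum ler10.
Qed.

Lemma card_model_size j :
  #|[pred delta : {ffun 'I_d -> bool} | model_size delta == j]| = 'C(d, j).
Proof.
rewrite -[in RHS](card_ord d) -card_draws.
pose toset (delta : {ffun 'I_d -> bool}) : {set 'I_d} := [set i | delta i]%SET.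
have toset_inj : injective toset.
  move=> x y /setP xy; apply/ffunP => i; have := xy i; by rewrite !inE.
rewrite -(card_imset _ toset_inj); apply: eq_card => B; rewrite !inE.
apply/imsetP/eqP => [[x]|cB].
  rewrite inE => /eqP <- ->; apply: eq_card => i; by rewrite !inE.
exists [ffun i => i \in B].
  rewrite inE -cB; apply/eqP; apply: eq_card => i.
  by rewrite inE /= ffunE.
by apply/setP => i; rewrite !inE ffunE.
Qed.

Lemma sum_model_weights m (x : R) :
  \sum_(delta | (m <= model_size delta)%N) (w delta)%:num * x ^+ model_size delta =
  \sum_(j < d.+1 | (m <= j)%N) g j * x ^+ j.
Proof.
have sz delta : (model_size delta < d.+1)%N.
  by rewrite ltnS -[leqRHS](card_ord d) max_card.
rewrite (partition_big (fun delta => Ordinal (sz delta)) (fun j => m <= j)%N)//=.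
apply: eq_bigr => j mj.
transitivity (\sum_(delta : {ffun 'I_d -> bool} | model_size delta == j)
    g j * ('C(d, j)%:R)^-1 * x ^+ j).
  apply: eq_big => [delta|delta /andP[_ /eqP <-]].
    by rewrite -val_eqE/=; case: eqP => [->|]; rewrite ?mj ?andbF.
  by rewrite w_g.
rewrite sumr_const card_model_size -mulr_natl.
have C0 : 'C(d, j)%:R != 0 :> R by rewrite pnatr_eq0 -lt0n bin_gt0 -ltnS.
by field.
Qed.

(** The induction is run on the stronger claim with 2 y^n added to the sum, which avoids dividing by
    1 - y. *)
Lemma sum_geometric_half_le (y : R) n : 0 <= y <= 2^-1 ->
  \sum_(i < n) y ^+ i <= 2.
Proof.
move=> /andP[y0 y12]; suff : \sum_(i < n) y ^+ i + 2 * y ^+ n <= 2.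
  by apply: le_trans; rewrite lerDl mulr_ge0// exprn_ge0.
elim: n => [|n IH]; first by rewrite big_ord0 add0r expr0 mulr1.
rewrite big_ord_recr/=; apply: le_trans IH; rewrite -addrA lerD2l exprS.
have : y * y ^+ n <= 2^-1 * y ^+ n by rewrite ler_wpM2r// exprn_ge0.
by lra.
Qed.

(** At size s + k + i the prior mass is at most U^(k + i) g s, so the terms are dominated by a
    geometric series in i of ratio x U. When s + k exceeds d the sum is empty. *)
Lemma sum_model_weights_le s k (x : R) : (s <= d)%N -> 0 < x -> x * U <= 2^-1 ->
  \sum_(delta | (s + k <= model_size delta)%N)
    (w delta)%:num * x ^+ model_size delta <= 2 * (x ^+ s * (x * U) ^+ k * g s).
Proof.
move=> sd x0 xU; rewrite sum_model_weights.
rewrite -(big_mkord (fun j => s + k <= j)%N (fun j => g j * x ^+ j)).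
have [skd|dsk] := leqP (s + k) d; last first.
  rewrite big_nat_cond big1 ?mulr_ge0 ?exprn_ge0 ?mulr_ge0 ?g_ge0// ?ltW//.
  by move=> j /andP[/andP[_ jd] skj]; move: jd; rewrite ltnNge (leq_trans dsk skj).
have skd' : (s + k <= d.+1)%N by rewrite (leq_trans skd).
rewrite (big_cat_nat (leq0n (s + k)%N) skd')//= big_nat_cond big1 ?add0r; last first.
  by move=> j /andP[/andP[_ jd] skj]; move: jd; rewrite ltnNge skj.
rewrite big_nat_cond (eq_bigl (fun j => (s + k <= j < d.+1)%N && true)); last first.
  by move=> j /=; rewrite andbT andbAC andbb.
rewrite -big_nat_cond -{1}[(s + k)%N]add0n big_addn big_mkord.
apply: (@le_trans _ _ (\sum_(i < d.+1 - (s + k)) (x * U) ^+ i *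
    (x ^+ s * (x * U) ^+ k * g s))).
  apply: ler_sum => i _.
  have iskd : (i + (s + k) <= d)%N.
    by rewrite -ltnS; have := ltn_ord i; rewrite ltn_subRL addnC.
  have -> : (i + (s + k) = s + (k + i))%N by rewrite addnC addnA.
  apply: (@le_trans _ _ (U ^+ (k + i) * g s * x ^+ (s + (k + i)))).
    rewrite ler_pM2r ?exprn_gt0// g_le_expU//.
    by rewrite addnA addnC.
  by rewrite !exprD !exprMn le_eqVlt; apply/orP; left; apply/eqP; ring.
rewrite -mulr_suml ler_wpM2r//.
  by rewrite !mulr_ge0 ?g_ge0// exprn_ge0 ?mulr_ge0// ltW.
by apply: sum_geometric_half_le; rewrite xU mulr_ge0// ltW.
Qed.

End model_weights.

(** * Measurability of the good events *)

Section measurable_closed_condition.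
Context {R : realType} {d : nat} {disp : measure_display}
  {T : measurableType disp}.

(* By continuity the condition need only be tested on a countable dense subset
   of [Theta], which exists whether or not [Theta] is measurable. *)
Lemma measurable_forall_le0 (Theta : set 'rV[R]_d) (G : 'rV[R]_d -> T -> R) :
  (forall u, measurable_fun setT (G u)) -> (forall z, continuous (G^~ z)) ->
  measurable [set z | forall u, Theta u -> G u z <= 0].
Proof.
move=> mG cG.
pose close (c : 'rV[rat]_d * nat) (u : 'rV[R]_d) :=
  Theta u /\ forall j, `|u ord0 j - ratr (c.1 ord0 j)| < c.2.+1%:R^-1.
(* A code is a rational centre with a precision; [u_] chooses for each code one point of [Theta]
   that close to the centre, if there is any. The chosen points form a countable dense subset of
   [Theta]. *)
pose u_ c := xget 0 [set u | close c u].
pose F n := if @choice.unpickle ('rV[rat]_d * nat)%type n is Some c then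
    [set z : T | (exists u, close c u) -> G (u_ c) z <= 0] else setT.
have -> : [set z | forall u, Theta u -> G u z <= 0] = \bigcap_n F n.
  apply/seteqP; split => z /= Hz.
    move=> n _; rewrite /F; case: choice.unpickle => // c [u cu].
    by apply: Hz; have [] := xgetI 0 (cu : [set u | close c u] u).
  move=> u Tu; rewrite leNgt; apply/negP => Gpos.
  have /nbhs_ballP[e /= e0 be] : \forall v \near u, 0 < G v z.
    exact: (cvgr_gt _ (cG z u)).
  (* Precision below e / 2, because the given point and the chosen point are compared through their
     common rational centre. *)
  have [n ne] : exists n, n.+1%:R^-1 < e / 2.
    exists (Num.trunc (e / 2)^-1); rewrite invf_plt ?posrE ?divr_gt0//.
    by rewrite truncnS_gt.
  have [p pu] : exists p : 'rV[rat]_d,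
      forall j, `|u ord0 j - ratr (p ord0 j)| < n.+1%:R^-1.
    have ex j : exists r : rat, `|u ord0 j - ratr r| < n.+1%:R^-1.
      have /rat_in_itvoo[r] : u ord0 j - n.+1%:R^-1 < u ord0 j + n.+1%:R^-1.
        by rewrite ltrD2l gtrN.
      by rewrite in_itv/= => rP; exists r; rewrite distrC ltr_distl.
    by exists (\row_j xchoose (ex j)) => j; rewrite mxE; exact: (xchooseP (ex j)).
  have cu : close (p, n) u by [].
  have [Tv cv] := xgetI 0 (cu : [set u | close (p, n) u] u).
  have := Hz (choice.pickle (p, n)) I.
  rewrite /F choice.pickleK => /(_ (ex_intro _ u cu)).
  rewrite leNgt => /negP; apply; apply: be; split => // i j.
  rewrite ord1 /ball/= (splitr e).
  rewrite (le_lt_trans (ler_distD (ratr (p ord0 j)) _ _))// ltrD//.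
    by rewrite (lt_trans (pu j)).
  by rewrite distrC (lt_trans (cv j)).
apply: bigcapT_measurable => n; rewrite /F.
case: choice.unpickle => [c|]; last exact: measurableT.
have [ex|nex] := pselect (exists u, close c u); last first.
  rewrite (_ : [set _ | _] = setT); first exact: measurableT.
  by apply/seteqP; split => // z _ /nex.
rewrite (_ : [set _ | _] = G (u_ c) @^-1` `]-oo, 0]); last first.
  by apply/seteqP; split => z /=; rewrite in_itv/=; [exact|move=> ? _].
by rewrite -[X in measurable X]setTI; exact: mG.
Qed.

Lemma continuous_addf (f h : 'rV[R]_d -> R) : continuous f -> continuous h ->
  continuous (fun u => f u + h u).
Proof. by move=> cf ch u; exact: continuousD (cf u) (ch u). Qed.

Lemma continuous_subf (f h : 'rV[R]_d -> R) : continuous f -> continuous h ->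
  continuous (fun u => f u - h u).
Proof. by move=> cf ch u; exact: continuousB (cf u) (ch u). Qed.

Lemma continuous_mulf (f h : 'rV[R]_d -> R) : continuous f -> continuous h ->
  continuous (fun u => f u * h u).
Proof. by move=> cf ch u; exact: continuousM (cf u) (ch u). Qed.

Lemma continuous_sum_coord (h : 'I_d -> 'rV[R]_d -> R) :
  (forall j, continuous (h j)) -> continuous (fun u => \sum_j h j u).
Proof.
by move=> ch; apply: continuous_big => [|j _ u]; [exact: add_continuous|exact: ch].
Qed.

Lemma continuous_l2 : continuous (@l2 R d).
Proof.
move=> u; apply: continuous_comp; last exact: sqrt_continuous.
apply: continuous_sum_coord => j v.
exact: (continuous_comp (@coord_continuous _ _ _ ord0 j v) (@exprn_continuous _ 2 _)).
Qed.

Lemma l2_ge0 (u : 'rV[R]_d) : 0 <= l2 u.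
Proof. exact: sqrtr_ge0. Qed.

Lemma continuous_dot (v : 'rV[R]_d) : continuous (dot v).
Proof.
apply: continuous_sum_coord => j u.
by apply: continuousM; [exact: cst_continuous|exact: (@coord_continuous _ _ _ ord0 j u)].
Qed.

(** [r] is continuous only within the closed half-line, but [l2] takes all its values there, so
    nothing outside is ever seen. *)
Lemma continuous_rate_l2 (r : R -> R) : rate_function r ->
  continuous (fun u : 'rV[R]_d => r (l2 u)).
Proof.
move=> [_ /subspace_continuousP rc _ _ _] u B Br.
have l2i (v : 'rV[R]_d) : `[0, +oo[%classic (l2 v).
  by rewrite /= in_itv/= andbT l2_ge0.
have H := continuous_l2 (rc _ (l2i u) _ Br).
apply: (@filterS _ (nbhs u) (nbhs_filter u) _ _ _ H) => v; apply; exact: l2i.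
Qed.

Variables (theta_star : 'rV[R]_d) (q : 'rV[R]_d -> T -> R).
Hypothesis mq : measurable_fun [set: 'rV[R]_d * T] (fun p => q p.1 p.2).
Hypothesis q_diff : forall z (theta : 'rV[R]_d),
  differentiable (fun t => ln (q t z)) theta.

Let shiftK u : theta_star + u - theta_star = u.
Proof. by rewrite addrC addKr. Qed.

Lemma measurable_ln_q theta : measurable_fun setT (fun z => ln (q theta z)).
Proof.
apply: measurableT_comp; first exact: measurable_ln.
exact: (measurableT_comp mq (pair1_measurable theta)).
Qed.

(** A partial derivative is the limit of difference quotients along the steps 1 / (n + 1), each of
    which is measurable in z. *)
Lemma measurable_grad_log j :
  measurable_fun setT (fun z => grad_log theta_star q z ord0 j).
Proof.
pose e : 'rV[R]_d := delta_mx ord0 j.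
apply: (measurable_fun_cvg (h := fun n z => n.+1%:R *
  (ln (q (n.+1%:R^-1 *: e + theta_star) z) - ln (q theta_star z)))) => [n|z _].
  by apply: measurable_funM => //; apply: measurable_funB; exact: measurable_ln_q.
rewrite mxE.
have /cvg_ex[l lP] := diff_derivable (v := e) (q_diff z theta_star).
rewrite /derive (cvg_lim _ lP)//.
have /cvgr_dnbhsP/(_ harmonic) := lP.
have h0 : forall n, harmonic n != 0 :> R by move=> n; rewrite invr_neq0.
move=> /(_ (conj h0 cvg_harmonic)); apply: cvg_trans; apply: near_eq_cvg.
by apply: nearW => n /=; rewrite invrK.
Qed.

Lemma measurable_dot_grad_log u :
  measurable_fun setT (fun z => dot (grad_log theta_star q z) u).
Proof.
apply: measurable_sum => j; apply: measurable_funM => //.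
exact: measurable_grad_log.
Qed.

Lemma measurable_Lcal theta : measurable_fun setT (Lcal theta_star q theta).
Proof.
apply: measurable_funB; last exact: measurable_dot_grad_log.
by apply: measurable_funB; exact: measurable_ln_q.
Qed.

Lemma continuous_Lcal z :
  continuous (fun u => Lcal theta_star q (theta_star + u) z).
Proof.
apply: continuous_subf; first apply: continuous_subf.
- move=> u.
  apply: (@continuous_comp _ _ _ (fun v => theta_star + v) (fun t => ln (q t z))).
    have cT : continuous (fun _ : 'rV[R]_d => theta_star) by exact: cst_continuous.
    exact: continuousD (cT u) cvg_id.
  exact: differentiable_continuous.
- exact: cst_continuous.
- rewrite (_ : (fun v => dot _ (theta_star + v - theta_star)) =
    dot (grad_log theta_star q z)); first exact: continuous_dot.
  by apply/funext => v; rewrite shiftK.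
Qed.

Lemma measurable_E1_check Theta r : rate_function r ->
  measurable (E1_check theta_star q Theta r).
Proof.
move=> rr; rewrite (_ : E1_check _ _ _ _ = [set z | forall u, Theta u ->
    Lcal theta_star q (theta_star + u) z + r (l2 u) / 2 <= 0]).
  apply: measurable_forall_le0 => [u|z].
    by apply: measurable_funD => //; exact: measurable_Lcal.
  apply: continuous_addf; first exact: continuous_Lcal.
  by apply: continuous_mulf; [exact: continuous_rate_l2|exact: cst_continuous].
apply/seteqP; split => z /= H.
  move=> u Tu; have /H := imageP (fun u => theta_star + u) Tu.
  by rewrite shiftK; lra.
move=> _ [u Tu <-]; have := H _ Tu.
by rewrite shiftK; lra.
Qed.

Lemma measurable_E1_hat Theta (L : R) : measurable (E1_hat theta_star q Theta L).
Proof.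
rewrite (_ : E1_hat _ _ _ _ = [set z | forall u, Theta u ->
    - (L / 2 * l2 u ^+ 2) - Lcal theta_star q (theta_star + u) z <= 0]).
  apply: measurable_forall_le0 => [u|z].
    by apply: measurable_funB => //; exact: measurable_Lcal.
  apply: continuous_subf; last exact: continuous_Lcal.
  rewrite (_ : (fun u => _) = (fun u => - (L / 2) * (l2 u * l2 u))); last first.
    by apply/funext => u; rewrite expr2 mulNr.
  apply: continuous_mulf; first exact: cst_continuous.
  by apply: continuous_mulf; exact: continuous_l2.
apply/seteqP; split => z /= H.
  move=> u Tu; have /H := imageP (fun u => theta_star + u) Tu.
  by rewrite shiftK; lra.
move=> _ [u Tu <-]; have := H _ Tu.
by rewrite shiftK; lra.
Qed.

Lemma measurable_grad_log_le (U : set 'rV[R]_d) (c : R) :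
  measurable [set z | forall u, U u -> `|dot (grad_log theta_star q z) u| <= c].
Proof.
rewrite (_ : [set _ | _] = [set z | forall u, U u ->
    `|dot (grad_log theta_star q z) u| - c <= 0]).
  apply: measurable_forall_le0 => [u|z].
    apply: measurable_funB => //; apply: measurableT_comp => //.
    exact: measurable_dot_grad_log.
  apply: continuous_subf; last exact: cst_continuous.
  by move=> u; apply: continuous_comp; [exact: continuous_dot|exact: norm_continuous].
by apply/seteqP; split => z /= H u /H; rewrite subr_le0.
Qed.

Lemma E0E Theta (lambda : R) : E0 theta_star q Theta lambda =
  [set z | forall u, Theta u /\ l2 u = 1 ->
     `|dot (grad_log theta_star q z) u| <= lambda / 2].
Proof.
apply/seteqP; split => z /= H.
  move=> u Tu; rewrite -lee_fin; apply: le_trans H.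
  by apply: ereal_sup_ubound; exists u.
by apply: ge_ereal_sup => _ [u Tu <-]; rewrite lee_fin; exact: H.
Qed.

Lemma measurable_E0 Theta (lambda : R) : measurable (E0 theta_star q Theta lambda).
Proof. by rewrite E0E; exact: measurable_grad_log_le. Qed.

Lemma dot_delta (v : 'rV[R]_d) j : dot v (delta_mx ord0 j) = v ord0 j.
Proof.
rewrite /dot (bigD1 j)//= mxE !eqxx mulr1 big1 ?addr0// => i ij.
by rewrite mxE (negPf ij) andbF mulr0.
Qed.

Lemma coord_le_mx_norm (v : 'rV[R]_d) j : `|v ord0 j| <= `|v|.
Proof.
have /mapP[i Hi ->] : `|v ord0 j| \in [seq `|v x.1 x.2| | x : 'I_1 * 'I_d].
  by apply/mapP; exists (ord0, j) => //=; rewrite mem_enum.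
by rewrite [leRHS]/Num.Def.normr /= mx_normrE; apply/bigmax_geP; right => /=; exists i.
Qed.

(** The sign of [lambda] matters for d = 0: the norm is then 0 while the condition on coordinates is
    vacuous. *)
Lemma E0_maxE (lambda : R) : 0 <= lambda -> E0_max theta_star q lambda =
  [set z | forall j, `|grad_log theta_star q z ord0 j| <= lambda / 2].
Proof.
move=> l0; apply/seteqP; split => z; rewrite /E0_max /= => H.
  by move=> j; apply: le_trans H; exact: coord_le_mx_norm.
rewrite [leLHS]/Num.Def.normr /= mx_normrE; apply/bigmax_leP; split.
  by rewrite divr_ge0.
by move=> -[i j] _ /=; rewrite ord1.
Qed.

Lemma measurable_E0_max (lambda : R) : 0 <= lambda ->
  measurable (E0_max theta_star q lambda).
Proof.
move=> l0; rewrite E0_maxE//.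
rewrite (_ : [set _ | _] = [set z | forall u, range (delta_mx ord0) u ->
    `|dot (grad_log theta_star q z) u| <= lambda / 2]).
  exact: measurable_grad_log_le.
apply/seteqP; split => z /= H.
  by move=> _ [j _ <-]; rewrite dot_delta.
by move=> j; rewrite -dot_delta; apply: H; exists j.
Qed.

End measurable_closed_condition.

(** * Vectors and cones *)

Section pointwise_bounds.
Context {R : realType} {d : nat}.
Implicit Types u v theta : 'rV[R]_d.

Lemma derive_dot_grad (h : 'rV[R]_d -> R) (a v : 'rV[R]_d) : differentiable h a ->
  'D_v h a = dot (grad h a) v.
Proof.
move=> dh; rewrite deriveE// [in LHS](row_sum_delta v) linear_sum/=.
apply: eq_bigr => j _; rewrite linearZ/= -deriveE// mxE.
by rewrite mulrC.
Qed.

(** By concavity every difference quotient of step 1 / (n + 1) in the direction [v] is at least the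
    full increment h (a + v) - h a; the inequality passes to the limit. *)
Lemma concave_le_tangent (h : 'rV[R]_d -> R) (a v : 'rV[R]_d) :
  convex_function [set: 'rV[R]_d] (fun theta => - h theta) ->
  differentiable h a -> h (a + v) - h a <= dot (grad h a) v.
Proof.
move=> ch dh; rewrite -derive_dot_grad//.
have /cvg_ex[l lP] := diff_derivable (v := v) dh.
rewrite /derive (cvg_lim _ lP)//.
have /cvgr_dnbhsP/(_ harmonic) := lP.
have h0 : forall n, harmonic n != 0 :> R by move=> n; rewrite invr_neq0.
move=> /(_ (conj h0 cvg_harmonic)) hl.
apply: (closed_cvg _ (@closed_ge R (h (a + v) - h a)) _ _ hl).
apply: nearW => n /=; rewrite invrK.
have t0 : 0 <= n.+1%:R^-1 :> R by [].
have t1 : n.+1%:R^-1 <= 1 :> R by rewrite invf_le1// ler1n.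
have H : - h (n.+1%:R^-1 *: (a + v) + (1 - n.+1%:R^-1) *: a) <=
    n.+1%:R^-1 * - h (a + v) + (1 - n.+1%:R^-1) * - h a.
  exact: (ch (Itv01 t0 t1) (a + v) a (in_setT _) (in_setT _)).
have aE : n.+1%:R^-1 *: (a + v) + (1 - n.+1%:R^-1) *: a = n.+1%:R^-1 *: v + a.
  by rewrite scalerDr scalerBl scale1r addrC addrA subrK addrC.
move: H; rewrite aE; set x := h _; rewrite mulrBl mul1r => H.
have n0 : 0 < n.+1%:R :> R by rewrite ltr0n.
rewrite -[leLHS](mulVKf (lt0r_neq0 n0)) -[leRHS]/(n.+1%:R * (x - h a)).
have aux (x' p p' k : R) : - x' <= - p + (- k - - p') -> p - p' <= x' - k by lra.
by rewrite ler_pM2l// mulrBr; apply: aux; move: H; rewrite !mulrN.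
Qed.

Lemma dot_scaler v (k : R) u : dot v (k *: u) = k * dot v u.
Proof. by rewrite mulr_sumr; apply: eq_bigr => j _; rewrite mxE; ring. Qed.

Lemma l2Z (k : R) u : 0 <= k -> l2 (k *: u) = k * l2 u.
Proof.
move=> k0; rewrite /l2 -[in RHS](ger0_norm k0) -sqrtr_sqr -sqrtrM ?sqr_ge0//.
by congr Num.sqrt; rewrite mulr_sumr; apply: eq_bigr => j _; rewrite mxE exprMn.
Qed.

Lemma l2_sqr u : l2 u ^+ 2 = \sum_j u ord0 j ^+ 2.
Proof. by rewrite sqr_sqrtr// sumr_ge0// => j _; rewrite sqr_ge0. Qed.

Lemma l2_eq0 u : l2 u = 0 -> u = 0.
Proof.
move=> u0; apply/rowP => j; rewrite mxE.
have := l2_sqr u; rewrite u0 expr0n/= => /esym/eqP.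
rewrite psumr_eq0 => [/allP/(_ j)|i _]; last exact: sqr_ge0.
by rewrite mem_index_enum sqrf_eq0 => /(_ isT)/eqP.
Qed.

Lemma l1_ge0 u : 0 <= l1 u.
Proof. exact: sumr_ge0. Qed.

Lemma l1_dot_sgn u : l1 u = dot (sgn u) u.
Proof. by apply: eq_bigr => j _; rewrite mxE normrEsg. Qed.

Lemma dot_le_max_l1 v u (c : R) : (forall j, `|v ord0 j| <= c) ->
  dot v u <= c * l1 u.
Proof.
move=> vc; rewrite mulr_sumr; apply: ler_sum => j _.
by rewrite (le_trans (ler_norm _))// normrM ler_wpM2r.
Qed.

Lemma l1_support_le_l2 (S : pred 'I_d) u :
  \sum_(j | S j) `|u ord0 j| <= Num.sqrt #|S|%:R * l2 u.
Proof.
set A := \sum_(j | S j) _; have A0 : 0 <= A by exact: sumr_ge0.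
have [S0|S0] := eqVneq #|S| 0%N.
  rewrite S0 sqrtr0 mul0r /A big1// => j Sj.
  by have : j \in S by []; rewrite (card0_eq S0).
rewrite -(ger0_norm A0) -sqrtr_sqr /l2 -sqrtrM//; apply: ler_wsqrtr.
set n : R := _%:R; have n0 : 0 < n by rewrite ltr0n lt0n.
have sS : \sum_(j | S j) u ord0 j ^+ 2 <= \sum_j u ord0 j ^+ 2.
  by rewrite [leRHS](bigID S)/= lerDl sumr_ge0// => j _; rewrite sqr_ge0.
apply: le_trans (ler_wpM2l (ltW n0) sS).
(* Cauchy-Schwarz by a variance: the nonnegative sum expands to n (n sum u_j^2 - A^2). *)
have : 0 <= \sum_(j | S j) (n * `|u ord0 j| - A) ^+ 2.
  by apply: sumr_ge0 => j _; exact: sqr_ge0.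
rewrite (_ : \sum_(j | S j) _ = n * (n * \sum_(j | S j) u ord0 j ^+ 2 - A ^+ 2)).
  by rewrite pmulr_rge0// subr_ge0.
transitivity (\sum_(j | S j) (n ^+ 2 * u ord0 j ^+ 2 - 2 * n * A * `|u ord0 j| + A ^+ 2)).
  by apply: eq_bigr => j _; rewrite -[u ord0 j ^+ 2]real_normK ?num_real//; ring.
rewrite big_split/= sumrB -!mulr_sumr -/A sumr_const.
by rewrite -[A *+ _]mulr_natl -/n; ring.
Qed.

Lemma l1_le_l2 u : l1 u <= Num.sqrt d%:R * l2 u.
Proof. by have := l1_support_le_l2 xpredT u; rewrite cardE size_enum_ord. Qed.

Lemma dot_sgn_le u v : `|dot (sgn u) v| <= l1 v.
Proof.
rewrite (le_trans (ler_norm_sum _ _ _))//; apply: ler_sum => j _.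
by rewrite normrM mxE ler_piMl// normr_sg lern1 leq_b1.
Qed.

(** Since |u|_1 = <sign u, u>, the pair u, u / |u|_2 is admissible in the double supremum. The bound
    [Num.sqrt d] on all inner products makes the real suprema genuine ones. *)
Lemma cone_const_bounds (Theta : set 'rV[R]_d) u : split_cone Theta -> Theta u ->
  0 <= cone_const Theta /\ l1 u <= cone_const Theta * l2 u.
Proof.
move=> [_ scale _] Tu.
pose inner w := [set `|dot (sgn w) v| | v in [set v : 'rV[R]_d | Theta v /\ l2 v = 1]].
have ub w : ubound (inner w) (Num.sqrt d%:R).
  move=> _ [v [_ v1] <-]; rewrite (le_trans (dot_sgn_le _ _))//.
  by rewrite (le_trans (l1_le_l2 v))// v1 mulr1.
have sup_le w : sup (inner w) <= Num.sqrt d%:R.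
  have [e0|/set0P ne] := eqVneq (inner w) set0; first by rewrite e0 sup0 sqrtr_ge0.
  exact: ge_sup.
have sup_ge w : 0 <= sup (inner w).
  have [e0|/set0P[x ix]] := eqVneq (inner w) set0; first by rewrite e0 sup0.
  have x0 : 0 <= x by case: ix => v _ <-.
  by apply: (le_trans x0); apply: ub_le_sup ix; exists (Num.sqrt d%:R); exact: ub.
have outer w : Theta w -> sup (inner w) <= cone_const Theta.
  move=> Tw; apply: ub_le_sup; last by exists w.
  by exists (Num.sqrt d%:R) => _ [w' _ <-]; exact: sup_le.
split; first exact: le_trans (sup_ge u) (outer _ Tu).
have [/l2_eq0 ->|u0] := eqVneq (l2 u) 0.
  rewrite /l1 big1 => [|j _]; last by rewrite mxE normr0.
  by rewrite mulr_ge0 ?l2_ge0 ?(le_trans (sup_ge u) (outer _ Tu)).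
have up : 0 < l2 u by rewrite lt0r u0 l2_ge0.
rewrite -ler_pdivrMr//; apply: le_trans (outer _ Tu).
apply: ub_le_sup; first by exists (Num.sqrt d%:R); exact: ub.
exists ((l2 u)^-1 *: u).
  split; first by apply: scale; rewrite // invr_ge0 ltW.
  by rewrite l2Z ?invr_ge0 ?ltW// mulVf.
by rewrite dot_scaler -l1_dot_sgn ger0_norm 1?mulrC// mulr_ge0 ?invr_ge0 ?l1_ge0// ltW.
Qed.

Lemma dot_cone_le (Theta : set 'rV[R]_d) v u (c : R) : split_cone Theta ->
  (forall u, Theta u /\ l2 u = 1 -> `|dot v u| <= c) ->
  Theta u -> dot v u <= c * l2 u.
Proof.
move=> [_ scale _] vc Tu.
have [/l2_eq0 ->|u0] := eqVneq (l2 u) 0.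
  have z0 : l2 (0 : 'rV[R]_d) = 0 by rewrite -(scale0r u) l2Z// mul0r.
  by rewrite z0 mulr0 /dot big1// => j _; rewrite mxE mulr0.
have up : 0 < l2 u by rewrite lt0r u0 l2_ge0.
have : `|dot v ((l2 u)^-1 *: u)| <= c.
  apply: vc; split; first by apply: scale; rewrite // invr_ge0 ltW.
  by rewrite l2Z ?invr_ge0 ?ltW// mulVf.
by rewrite dot_scaler => /(le_trans (ler_norm _)); rewrite ler_pdivrMl// mulrC.
Qed.

End pointwise_bounds.

(** * Likelihood ratio on the good events *)

Section likelihood_ratio_bounds.
Context {R : realType} {d : nat} {disp : measure_display}
  {T : measurableType disp}.
Variables (theta_star : 'rV[R]_d) (q : 'rV[R]_d -> T -> R).
Hypothesis q_gt0 : forall theta z, 0 < q theta z.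
Hypothesis q_concave : forall z,
  convex_function [set: 'rV[R]_d] (fun theta => - ln (q theta z)).
Hypothesis q_diff : forall z (theta : 'rV[R]_d),
  differentiable (fun t => ln (q t z)) theta.

Let addKstar theta : theta_star + (theta - theta_star) = theta.
Proof. by rewrite addrC subrK. Qed.

Lemma q_le_expR z theta (k : R) :
  Lcal theta_star q theta z + dot (grad_log theta_star q z) (theta - theta_star) <= k ->
  q theta z <= q theta_star z * expR k.
Proof.
move=> H; rewrite -[leLHS](@lnK _) ?posrE// -[q theta_star z](@lnK _) ?posrE//.
by rewrite -expRD ler_expR; move: H; rewrite /Lcal; lra.
Qed.

Lemma q_ge_expR z theta (k : R) :
  k <= Lcal theta_star q theta z + dot (grad_log theta_star q z) (theta - theta_star) ->
  q theta_star z * expR k <= q theta z.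
Proof.
move=> H; rewrite -[leRHS](@lnK _) ?posrE// -[q theta_star z](@lnK _) ?posrE//.
by rewrite -expRD ler_expR; move: H; rewrite /Lcal; lra.
Qed.

Lemma Lcal_le0 z theta : Lcal theta_star q theta z <= 0.
Proof.
rewrite /Lcal subr_le0 -{1}(addKstar theta).
exact: (concave_le_tangent (theta - theta_star) (q_concave z) (q_diff z theta_star)).
Qed.

Let S : pred 'I_d := delta_star theta_star.

(** On the support this is the triangle inequality; off it [theta_star] vanishes, so theta and theta
    - theta_star have the same coordinates there. *)
Lemma l1_off_support theta :
  l1 theta_star - l1 theta <= \sum_(j | S j) `|(theta - theta_star) ord0 j| -
    \sum_(j | ~~ S j) `|(theta - theta_star) ord0 j|.
Proof.
have -> : l1 theta_star = \sum_(j | S j) `|theta_star ord0 j|.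
  rewrite /l1 (bigID S)/= [X in _ + X]big1 ?addr0// => j.
  by rewrite /S ffunE negbK => /eqP ->; rewrite normr0.
have -> : l1 theta = \sum_(j | S j) `|theta ord0 j| +
    \sum_(j | ~~ S j) `|(theta - theta_star) ord0 j|.
  rewrite /l1 (bigID S)/=; congr (_ + _); apply: eq_bigr => j.
  by rewrite /S ffunE negbK !mxE => /eqP ->; rewrite subr0.
rewrite opprD addrA lerD2r lerBlDr -big_split/=; apply: ler_sum => j _.
rewrite !mxE distrC -[leLHS]/`|theta_star ord0 j|.
by rewrite -{1}(subrK (theta ord0 j) (theta_star ord0 j)) ler_normD.
Qed.

Lemma l1_sub_le theta : l1 theta_star - l1 theta <= l1 (theta - theta_star).
Proof.
apply: le_trans (l1_off_support theta) _; rewrite [leRHS](bigID S)/= lerD2l.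
have B0 : 0 <= \sum_(j | ~~ S j) `|(theta - theta_star) ord0 j| by exact: sumr_ge0.
by rewrite (le_trans _ B0)// oppr_le0.
Qed.

Lemma Ncone_bound (rho e : R) r z theta :
  0 < rho -> 0 <= e ->
  (Ncone theta_star !=set0 -> forall x, 0 < x ->
     - 2^-1 * (r x - 4 * rho * Num.sqrt (l0 theta_star)%:R * x) <= e) ->
  E0_max theta_star q rho z -> E1_check theta_star q (Ncone theta_star) r z ->
  q theta z <= expR e * q theta_star z *
    expR (rho * l1 theta - rho * l1 theta_star - rho / 4 * l1 (theta - theta_star)).
Proof.
move=> rho0 e0 He; rewrite (E0_maxE _ _ (ltW rho0)) /= => Hg HN.
set u := theta - theta_star; set k := _ - _.
rewrite [expR e * _]mulrC -mulrA -expRD; apply: q_le_expR; rewrite -/u.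
have := l1_off_support theta; rewrite -/u.
set A := \sum_(j | S j) _; set B := \sum_(j | ~~ S j) _ => HAB.
have A0 : 0 <= A by exact: sumr_ge0.
have B0 : 0 <= B by exact: sumr_ge0.
have uAB : l1 u = A + B by rewrite /l1 (bigID S).
have dotle : dot (grad_log theta_star q z) u <= rho / 2 * (A + B).
  by rewrite -uAB; apply: dot_le_max_l1.
(* The gradient costs rho (A + B) / 2, the comparison of l1 norms rho (A - B), and the kept reserve
   rho (A + B) / 4. The total is rho (7 A - B) / 4, which is where the 7 in [Ncone] comes from. *)
suff HL : Lcal theta_star q theta z <= e + rho * (B / 4 - 7 * A / 4).
  have : rho * (l1 theta_star - l1 theta) <= rho * (A - B) by rewrite ler_pM2l.
  by rewrite /k uAB; lra.
have AE : l1 (hadamard u (\row_j (delta_star theta_star j)%:R)) = A.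
  rewrite /l1 (bigID S)/= [X in _ + X]big1 ?addr0 => [|j Sj].
    by apply: eq_bigr => j Sj; rewrite !mxE -/(S j) Sj mulr1.
  by rewrite !mxE -/(S j) (negPf Sj) mulr0 normr0.
(* Off the cone 7 A <= B, so the target is nonnegative and [Lcal_le0] suffices. *)
have [[Nu uN0]|nN] := pselect (Ncone theta_star u /\ u != 0); last first.
  have BA : 7 * A <= B.
    rewrite leNgt; apply/negP => BA; apply: nN.
    suff u0 : u != 0 by split=> //; split => //; rewrite AE ltW.
    apply/eqP => u0; move: BA; rewrite /A big1 => [|j _]; last first.
      by rewrite u0 mxE normr0.
    by rewrite mulr0 ltNge B0.
  apply: (le_trans (Lcal_le0 z theta)); rewrite addr_ge0// mulr_ge0 ?(ltW rho0)//.
  by lra.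
have u0 : 0 < l2 u.
  rewrite lt0r l2_ge0 andbT; apply: contra uN0 => /eqP u0.
  by apply/eqP; exact: l2_eq0.
have := HN theta; rewrite /translate => /(_ (ex_intro2 _ _ u Nu (addKstar theta))).
rewrite -/u => HL; apply: (le_trans HL).
(* On the cone [He] reads - r / 2 <= e - 2 rho sqrt(s) |u|_2, and 7 A / 4 <= 2 A <= 2 sqrt(s)
   |u|_2. *)
have := He (ex_intro _ u Nu) _ u0.
have AS : A <= Num.sqrt (l0 theta_star)%:R * l2 u.
  rewrite -model_size_delta_star; exact: l1_support_le_l2.
have : rho * A <= rho * (Num.sqrt (l0 theta_star)%:R * l2 u) by rewrite ler_pM2l.
have : 0 <= rho * A by rewrite mulr_ge0// ltW.
have : 0 <= rho * B by rewrite mulr_ge0// ltW.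
rewrite -!mulrA; set x := rho * (Num.sqrt _ * _).
lra.
Qed.

Lemma cone_bound (Theta : set 'rV[R]_d) (rho lambda eps M : R) r z theta (j : nat) :
  split_cone Theta -> 0 < rho -> 0 <= lambda -> 0 < eps -> 2 < M ->
  rate_function r -> (phi_rate r (2 * lambda) = eps%:E)%E ->
  E0 theta_star q Theta lambda z -> E1_check theta_star q Theta r z ->
  translate theta_star Theta theta -> (0 < j)%N ->
  j%:R * M * eps < l2 (theta - theta_star) <= j.+1%:R * M * eps ->
  q theta z <= expR (- (r (j%:R * M * eps / 2) / 8)) *
      expR (3 * rho * cone_const Theta * j%:R * M * eps) * q theta_star z *
    expR (rho * l1 theta - rho * l1 theta_star - rho / 2 * l1 (theta - theta_star)).
Proof.
move=> cT rho0 lambda0 eps0 M2 rr phi; rewrite E0E /= => Hg HN tT j0.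
have [u Tu uE] := tT.
have uE' : theta - theta_star = u by rewrite -uE addrC addKr.
rewrite uE' => /andP[ju uj].
set c0 := cone_const Theta; set k := _ - _.
have [c00 l1u] := cone_const_bounds cT Tu; rewrite -/c0 in c00 l1u.
set b := r _ / 8; set p := 3 * _ * _ * _ * _ * _.
have -> : expR (- b) * expR p * q theta_star z * expR k =
    q theta_star z * expR (- b + p + k) by rewrite !expRD; ring.
apply: q_le_expR; rewrite uE'; set x := l2 u in ju uj l1u *.
have M0 : 0 < M by rewrite (lt_trans _ M2).
have Me0 : 0 < M * eps by rewrite mulr_gt0.
have j1 : 1 <= j%:R :> R by rewrite ler1n.
have jMe : M * eps <= j%:R * M * eps by rewrite -mulrA ler_peMl// ltW.
have epsx : eps < x.
  apply: le_lt_trans ju; apply: le_trans jMe; rewrite ler_peMl// ?(ltW eps0)//.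
  by rewrite (le_trans _ (ltW M2))// ler1n.
have [r0 _ rhomo _ _] := rr.
have x0 : 0 < x by rewrite (lt_trans eps0).
(* As x lies strictly above the infimum eps, some admissible threshold lies below x. The gradient
   term lambda x / 2 is thus at most r x / 4. *)
have rx : 2 * lambda * x <= r x.
  have : (phi_rate r (2 * lambda) < x%:E)%E by rewrite phi lte_fin.
  by move=> /ereal_inf_lt[_ [y [y0 Hy] <-]]; rewrite lte_fin => /ltW; exact: Hy.
have rb : 2 * b <= r x / 4.
  have jx0 : 0 <= j%:R * M * eps / 2 by rewrite divr_ge0// (le_trans (ltW Me0)).
  have : r (j%:R * M * eps / 2) < r x.
    apply: rhomo; rewrite ?in_itv/= ?andbT ?(ltW x0)//.
    by apply: le_lt_trans ju; rewrite ler_piMr ?(le_trans (ltW Me0))// invf_le1// ler1n.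
  by rewrite /b; lra.
have b0 : 0 <= b.
  rewrite divr_ge0// r0// divr_ge0// (le_trans (ltW Me0))//.
have dotle : dot (grad_log theta_star q z) u <= lambda / 2 * x.
  exact: dot_cone_le cT Hg Tu.
have := HN theta tT; rewrite uE' -/x => HL.
(* Here k >= - (1 + 1/2) rho |u|_1, and |u|_1 <= c0 (j + 1) M eps <= 2 c0 j M eps because j >= 1;
   this gives the constant 3 in [p]. *)
suff pk : 0 <= p + k by lra.
have l1s : rho * (l1 theta_star - l1 theta) <= rho * l1 u.
  by rewrite ler_pM2l// -uE' l1_sub_le.
have l1c : l1 u <= c0 * (2 * (j%:R * M * eps)).
  apply: (le_trans l1u); rewrite ler_wpM2l//; apply: (le_trans uj).
  by rewrite -!mulrA [leRHS]mulrA ler_pM2r// -natr1; lra.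
have : rho * l1 u <= rho * (c0 * (2 * (j%:R * M * eps))) by rewrite ler_pM2l.
have -> : p = 3 / 2 * (rho * (c0 * (2 * (j%:R * M * eps)))) by rewrite /p; field.
by rewrite /k; lra.
Qed.

Section normalised.
Variables (w : {ffun 'I_d -> bool} -> {nonneg R}) (rho : {posnum R}).
Hypothesis mq : measurable_fun [set: 'rV[R]_d * T] (fun p => q p.1 p.2).

Lemma quasi_posterior_ge0 (A : set 'rV[R]_d) z :
  (0 <= quasi_posterior (prior w rho) q A z)%E.
Proof.
rewrite /quasi_posterior mule_ge0//.
  by apply: integral_ge0 => theta _; rewrite lee_fin ltW.
rewrite inve_ge0; apply: integral_ge0 => theta _; by rewrite lee_fin ltW.
Qed.

Lemma quasi_posterior_le1 (A : set 'rV[R]_d) z :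
  (0 < \int[prior w rho]_theta (q theta z)%:E < +oo)%E ->
  (quasi_posterior (prior w rho) q A z <= 1)%E.
Proof.
move=> /andP[I0 Ioo]; rewrite /quasi_posterior.
have : (\int[prior w rho]_(theta in A) (q theta z)%:E <=
    \int[prior w rho]_theta (q theta z)%:E)%E.
  rewrite [leLHS]integral_mkcond; apply: ge0_le_lower_integral => theta _.
    by apply: erestrict_ge0 => x _; rewrite lee_fin ltW.
  by rewrite patchE; case: ifP => _ //; rewrite lee_fin ltW.
move: I0 Ioo; case: (\int[_]_theta _)%E => // D; rewrite lte_fin => D0 _ AD.
by rewrite inver (gt_eqF D0) lee_pdivrMr// mul1e.
Qed.

(** Numerator and denominator both carry q_theta_star exp (- rho |theta_star|_1), which cancels. The
    gradient, unbounded on this event as far as the denominator is concerned, enters there only as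
    the tilt [G]. *)
Lemma quasi_posterior_le (A : set 'rV[R]_d) z (K kappa L : R) m :
  (0 < \int[prior w rho]_theta (q theta z)%:E < +oo)%E ->
  0 <= K -> 0 < kappa -> 0 <= L -> 0 < (w (delta_star theta_star))%:num ->
  (forall theta, A theta -> (m <= l0 theta)%N) ->
  (forall theta, A theta -> q theta z <= K * q theta_star z *
    expR (rho%:num * l1 theta - rho%:num * l1 theta_star -
          kappa * l1 (theta - theta_star))) ->
  E1_hat theta_star q (Theta_star theta_star) L z ->
  (quasi_posterior (prior w rho) q A z <=
   (K * (1 + L / rho%:num ^+ 2) ^+ l0 theta_star / (w (delta_star theta_star))%:num *
     \sum_(delta | (m <= model_size delta)%N)
        (w delta)%:num * (rho%:num / kappa) ^+ model_size delta)%:E)%E.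
Proof.
move=> /andP[I0 Ioo] K0 k0 L0 w0 Am Aq HL.
have qs0 : 0 < q theta_star z by [].
have num := prior_integral_le w (mulr_ge0 K0 (ltW qs0)) k0
  (fun theta _ => ltW (q_gt0 theta z)) Am Aq.
have mqz : measurable_fun setT (fun theta => q theta z).
  exact: (measurableT_comp mq (pair2_measurable z)).
have den : ((q theta_star z * expR (- (rho%:num * l1 theta_star)) *
     ((w (delta_star theta_star))%:num / (1 + L / rho%:num ^+ 2) ^+ l0 theta_star))%:E <=
   \int[prior w rho]_theta (q theta z)%:E)%E.
  apply: (prior_integral_ge w rho (G := grad_log theta_star q z)) => //; first exact: ltW.
    by move=> theta; rewrite ltW.
  move=> theta supp; apply: q_ge_expR; rewrite addrC lerD2r.
  apply: HL; exists (theta - theta_star); last exact: addKstar.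
  by move=> j sj; rewrite !mxE supp// sj subrr.
move: num den; rewrite /quasi_posterior.
set N := (X in (_ <= X%:E)%E); set D0 := (X in (X%:E <= _)%E).
move=> num; move: I0 Ioo; case: (\int[_]_theta _)%E => // D.
rewrite lte_fin lee_fin => Dp _ D0D.
rewrite inver (gt_eqF Dp) lee_pdivrMr// (le_trans num)// -EFinM lee_fin.
set C := (X in X * D); have P0 : 0 < 1 + L / rho%:num ^+ 2.
  by rewrite ltr_pwDl// divr_ge0// sqr_ge0.
have C0 : 0 <= C.
  rewrite mulr_ge0 ?sumr_ge0//; first by rewrite divr_ge0// mulr_ge0// exprn_ge0// ltW.
  by move=> delta _; rewrite mulr_ge0// exprn_ge0// divr_ge0// ltW.
apply: le_trans (ler_wpM2l C0 D0D).
rewrite /N /C /D0 le_eqVlt; apply/orP; left; apply/eqP; field.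
by rewrite expf_neq0 ?lt0r_neq0.
Qed.

End normalised.

End likelihood_ratio_bounds.

(** * From a bound on the good event to a bound in expectation *)

Section good_event.
Local Open Scope ereal_scope.
Context {d} {T : measurableType d} {R : realType} (P : probability T R).

(** [h] may be nonmeasurable, so it is compared with the measurable majorant 1 off E, plus c, plus
    +oo on B. The last term covers the null set, where [h] is uncontrolled, and integrates to 0. *)
Lemma integral_le_good_event (h : T -> \bar R) (E B : set T) (c : R) :
  (0 <= c)%R -> measurable E -> measurable B -> P B = 0 ->
  (forall z, 0 <= h z) -> (forall z, ~ B z -> h z <= 1) ->
  (forall z, ~ B z -> E z -> h z <= c%:E) ->
  \int[P]_z h z <= P (~` E) + c%:E.
Proof.
move=> c0 mE mB PB0 h0 h1 hc.
have mE' := measurableC mE.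
have m1 (A : set T) : measurable A -> measurable_fun setT (fun z => (\1_A z)%:E : \bar R).
  by move=> mA; apply/measurable_EFinP; exact: measurable_indic.
have -> : P (~` E) + c%:E = \int[P]_z ((\1_(~` E) z)%:E + c%:E + +oo * (\1_B z)%:E).
  rewrite ge0_integralD//; last 3 first.
  - by move=> z _; rewrite -EFinD lee_fin addr_ge0.
  - by apply: emeasurable_funD => //; exact: m1.
  - by apply: emeasurable_funM; [exact: measurable_cst|exact: m1].
  rewrite ge0_integralD//; last exact: m1.
  rewrite ge0_integralZl//; last exact: m1.
  rewrite !integral_indic// !setIT [X in +oo * X](_ : _ = 0)// mule0 adde0.
  by rewrite integral_cst// [X in c%:E * X](_ : _ = 1) ?mule1//; exact: probability_setT.
apply: ge0_le_lower_integral => // z _; rewrite !indicE.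
case: (boolP (z \in B)) => [_|/negP/negP nB].
  by rewrite mule1 addeC leey.
rewrite mule0 adde0; have {}nB : ~ B z by move=> Bz; move: nB; rewrite mem_set.
have [Ez|nEz] := pselect (E z).
  by rewrite memNset ?add0e ?hc//; exact.
by rewrite mem_set//; apply: (le_trans (h1 _ nB)); rewrite -EFinD lee_fin lerDl.
Qed.

End good_event.

(** * Sign of the exponent, packing numbers and shells *)

Section exponents_and_packings.
Context {R : realType} {d : nat}.

(** Near 0 one has r x < x, so the infimum is below every positive e. This makes the exponent of
    part (1) nonnegative, as the bound off the cone requires. *)
Lemma inf_rate_le0 (r : R -> R) (c : R) : rate_function r -> 0 <= c ->
  (ereal_inf [set (r x - c * x)%:E | x in [set x : R | (0 < x)%R]] <= 0)%E.
Proof.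
move=> [_ _ _ _ r0] c0; apply/lee_addgt0Pr => e e0; rewrite add0e.
have : \forall x \near 0^'+, r x / x < 1 by exact: (cvgr_lt _ r0).
move=> r1; have [x [[x0 xe] rx]] : exists x, (0 < x /\ x <= e) /\ r x / x < 1.
  near (0 : R)^'+ => x; exists x; split; last by near: x.
  by split; near: x; [exact: nbhs_right_gt|exact: nbhs_right_le].
apply: (@le_trans _ _ (r x - c * x)%:E); first by apply: ereal_inf_lbound; exists x.
move: rx; rewrite ltr_pdivrMr// mul1r => rx; rewrite lee_fin.
have : 0 <= c * x by rewrite mulr_ge0// ltW.
by lra.
Unshelve. all: by end_near. Qed.

Lemma a_exponent_ge0 (a : 'rV[R]_d) (r : R -> R) (rho : R) : rate_function r ->
  0 <= rho -> (0 <= a_exponent a r rho)%E.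
Proof.
move=> rr rho0; rewrite /a_exponent; case: asboolP => // _.
rewrite EFinN mulNe -muleN mule_ge0// oppe_ge0.
by apply: inf_rate_le0 => //; rewrite !mulr_ge0// sqrtr_ge0.
Qed.

Lemma a_exponent_le (a : 'rV[R]_d) (r : R -> R) (rho e : R) :
  a_exponent a r rho = e%:E -> Ncone a !=set0 ->
  forall x, 0 < x -> - 2^-1 * (r x - 4 * rho * Num.sqrt (l0 a)%:R * x) <= e.
Proof.
rewrite /a_exponent; case: asboolP => // _ + _ x x0.
set I := ereal_inf _; have : (I <= (r x - 4 * rho * Num.sqrt (l0 a)%:R * x)%:E)%E.
  by apply: ereal_inf_lbound; exists x.
case: I => [i| |].
- by rewrite lee_fin -EFinM => ix [<-]; rewrite ler_wnM2l// oppr_le0.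
- by [].
- by rewrite EFinN mulNe mulrNy gtr0_sg// ?mul1e.
Qed.

Lemma packing_ge0 (eps : R) (B : set 'rV[R]_d) : (0 <= packing eps B)%E.
Proof.
by apply: ereal_sup_ubound; exists fset0; rewrite ?cardfs0//; split.
Qed.

Lemma phi_rate_ge0 (r : R -> R) (c : R) : (0 <= phi_rate r c)%E.
Proof. by apply: le_ereal_inf_tmp => _ [x [x0 _] <-]; rewrite lee_fin ltW. Qed.

Lemma exists_shell (x h : R) : 0 < h -> h < x ->
  exists2 j : nat, (0 < j)%N & j%:R * h < x <= j.+1%:R * h.
Proof.
move=> h0 hx.
have ex : exists n : nat, x <= n.+1%:R * h.
  exists (Num.trunc (x / h)); rewrite -ler_pdivrMr// ltW//.
  by rewrite truncnS_gt.
case: (ex_minnP ex) => j xj jmin; exists j.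
  by case: j xj {jmin} => //; rewrite mul1r leNgt hx.
rewrite xj andbT; case: j xj jmin => [|j] xj jmin.
  by rewrite mul0r (lt_trans h0).
by rewrite ltNge; apply/negP => /jmin; rewrite ltnn.
Qed.

Lemma sum_one_pinfty : (\sum_(1 <= j <oo) (1 : R)%:E = +oo)%E.
Proof.
have s0 n : (\sum_(1 <= j < n.+1) (1 : R)%:E <= \sum_(1 <= j <oo) (1 : R)%:E)%E.
  by apply: nneseries_lim_ge => j _ _; rewrite lee_fin.
apply/eqyP => x x0; apply: le_trans (s0 (Num.trunc x).+1).
rewrite sumEFin big_const_nat iter_addr_0 subSS subn0 lee_fin ltW//.
by rewrite truncnS_gt.
Qed.

End exponents_and_packings.

(** * The two contraction bounds *)

Theorem theorem3 (R : realType) (d : nat)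
  (disp : measure_display) (T : measurableType disp)
  (dz : {sigma_finite_measure set T -> \bar R})
  (theta_star : 'rV[R]_d)
  (f : T -> R) (P : probability T R)
  (q : 'rV[R]_d -> T -> R)
  (rho : {posnum R}) (w : {ffun 'I_d -> bool} -> {nonneg R})
  (g : nat -> R) (c1 c2 c3 c4 : R)
  (Theta : set 'rV[R]_d) (L lambda eps : R) (r : R -> R)
  (mf : measurable_fun [set: T] f)
  (f_ge0 : forall z, 0 <= f z)
  (Pf : forall A, measurable A -> P A = (\int[dz]_(z in A) (f z)%:E)%E)
  (mq : measurable_fun [set: 'rV[R]_d * T] (fun p => q p.1 p.2))
  (q_gt0 : forall theta z, 0 < q theta z)
  (q_int : {ae dz, forall z,
     (0 < \int[prior w rho]_theta (q theta z)%:E < +oo)%E})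
  (q_concave : forall z,
     convex_function [set: 'rV[R]_d] (fun theta => - ln (q theta z)))
  (q_diff : forall z (theta : 'rV[R]_d),
     differentiable (fun t => ln (q t z)) theta)
  (w_sum : \sum_(delta : {ffun 'I_d -> bool}) (w delta)%:num = 1)
  (g_ge0 : forall s, (s <= d)%N -> 0 <= g s)
  (g_sum : \sum_(s < d.+1) g s = 1)
  (w_g : forall delta, (w delta)%:num =
     g (model_size delta) * ('C(d, model_size delta)%:R)^-1)
  (c1_gt0 : 0 < c1) (c2_gt0 : 0 < c2) (c3_gt0 : 0 < c3) (c4_gt0 : 0 < c4)
  (c34 : c4 <= c3)
  (g_ratio : forall s, (1 <= s <= d)%N ->
     c1 / (d%:R `^ c3) * g s.-1 <= g s <= c2 / (d%:R `^ c4) * g s.-1)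
  (d_c4 : 8 * c2 <= d%:R `^ c4)
  (Theta_cone : split_cone Theta)
  (Theta_sup : Theta_star theta_star `<=` Theta)
  (L_ge0 : 0 <= L) (lambda_ge0 : 0 <= lambda)
  (r_rate : rate_function r)
  (phi_eps : phi_rate r (2 * lambda) = eps%:E) :
  let s := l0 theta_star in
  (let E := E0_max theta_star q rho%:num
            `&` E1_hat theta_star q (Theta_star theta_star) L
            `&` E1_check theta_star q (Ncone theta_star) r in
   forall k : nat,
   (\int[P]_z quasi_posterior (prior w rho) q
        [set theta | (s + k <= l0 theta)%N] z <=
    P (~` E) +
    2%:E * expeR (a_exponent theta_star r rho%:num) *
      ((4 + 4 * L / rho%:num ^+ 2) ^+ s * 'C(d, s)%:R *
       (4 * c2 / d%:R `^ c4) ^+ k)%:E)%E)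
  /\
  (let E := E0 theta_star q Theta lambda
            `&` E1_hat theta_star q (Theta_star theta_star) L
            `&` E1_check theta_star q Theta r in
   forall M0 : R, 2 < M0 ->
   let D (j : nat) := packing (j%:R * M0 * eps / 2)
      (Bset theta_star Theta (j.+1%:R * M0 * eps)) in
   let c0 := cone_const Theta in
   (\int[P]_z quasi_posterior (prior w rho) q
        [set theta | translate theta_star Theta theta /\
                     (M0 * eps < l2 (theta - theta_star))%R] z <=
    P (~` E) +
    (\sum_(1 <= j <oo)
       D j * (expR (- (r (j%:R * M0 * eps / 2) / 8)))%:E) +
    (2 * 'C(d, s)%:R * (d%:R `^ c3 / c1) ^+ s * (1 + L / rho%:num ^+ 2) ^+ s)%:E *
    \sum_(1 <= j <oo)
      (expR (- (r (j%:R * M0 * eps / 2) / 8)) *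
       expR (3 * rho%:num * c0 * j%:R * M0 * eps))%:E)%E).
Proof.
move=> s; set sbar := d%:R `^ c4 in d_c4 g_ratio *.
have D4 : 0 < sbar by apply: lt_le_trans d_c4; rewrite mulr_gt0.
have d0 : 0 < d%:R :> R.
  (* For d = 0 the power d^c4 with c4 > 0 would be 0, contradicting 8 c2 > 0. *)
  rewrite lt0r ler0n andbT; apply/eqP => d0; move: D4.
  by rewrite /sbar d0 powR0 ?gt_eqF// ltxx.
have D3 : 0 < d%:R `^ c3 by exact: powR_gt0.
pose U := c2 / sbar; pose V := d%:R `^ c3 / c1.
have U0 : 0 < U by rewrite divr_gt0.
have V0 : 0 < V by rewrite divr_gt0.
have g_le n : (1 <= n <= d)%N -> g n <= U * g n.-1 by move=> /g_ratio/andP[].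
have g_ge n : (1 <= n <= d)%N -> g n.-1 <= V * g n.
  move=> /g_ratio/andP[+ _]; rewrite /V -[X in _ -> _ <= X * _]invf_div.
  by rewrite ler_pdivlMl// divr_gt0.
have U8 : 8 * U <= 1 by rewrite /U mulrA ler_pdivrMr// mul1r.
have sd : (s <= d)%N by rewrite -[leqRHS](card_ord d) max_card.
have gs0 : 0 < g s := g_gt0 g_ge0 g_sum U0 V0 g_le g_ge sd.
have C0 : 0 < 'C(d, s)%:R :> R by rewrite ltr0n bin_gt0.
have wE : (w (delta_star theta_star))%:num = g s / 'C(d, s)%:R.
  by rewrite w_g model_size_delta_star.
have w0 : 0 < (w (delta_star theta_star))%:num by rewrite wE divr_gt0.
have [B [mB dzB0 subB]] := q_int.
have PB0 : P B = 0%E.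
  rewrite Pf// null_set_integral//; apply/measurable_EFinP.
  exact: measurable_funTS.
have q_intB z : ~ B z -> (0 < \int[prior w rho]_theta (q theta z)%:E < +oo)%E.
  by move=> nB; apply: contrapT => H; apply: nB; exact: subB.
have rho0 : 0 < rho%:num by [].
have Lr0 : 0 <= L / rho%:num ^+ 2 by rewrite divr_ge0// sqr_ge0.
split.
- move=> E k.
  have mE : measurable E.
    apply: measurableI; first apply: measurableI.
    + exact: measurable_E0_max.
    + exact: measurable_E1_hat.
    + exact: measurable_E1_check.
  have U12 : 4 * U <= 2^-1 by lra.
  have F0 : 0 < (4 + 4 * L / rho%:num ^+ 2) ^+ s * 'C(d, s)%:R * (4 * c2 / sbar) ^+ k.
    by rewrite !mulr_gt0 ?exprn_gt0 ?divr_gt0 ?mulr_gt0// ltr_pwDl// -mulrA mulr_ge0.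
  have := a_exponent_ge0 theta_star r_rate (ltW rho0).
  (* Nonnegativity rules out -oo, and for +oo the right-hand side is +oo because its other factors
     are positive. *)
  case aE : (a_exponent _ _ _) => [e| |]//; last first.
    move=> _; rewrite /= gt0_muley// gt0_mulye ?lte_fin// addey ?leey//.
    by rewrite gt_eqF// (lt_le_trans (ltNyr 0))// measure_ge0.
  rewrite lee_fin => e0; rewrite -!EFinM.
  have [_ He] := (I, a_exponent_le aE).
  apply: (integral_le_good_event _ mE mB PB0) => [|z|z nB|z nB [[Hg Hh] Hc]].
  + by rewrite mulr_ge0 ?(ltW F0)// mulr_ge0 ?expR_ge0.
  + exact: quasi_posterior_ge0.
  + exact: quasi_posterior_le1 (q_intB _ nB).
  have k4 : 0 < rho%:num / 4 by rewrite divr_gt0.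
  have := quasi_posterior_le q_gt0 mq (A := [set theta | (s + k <= l0 theta)%N])
    (q_intB _ nB) (expR_ge0 e) k4 L_ge0 w0 (fun _ => id)
    (fun theta _ => Ncone_bound q_gt0 q_concave q_diff theta rho0 e0 He Hg Hc) Hh.
  move=> /le_trans; apply; rewrite lee_fin.
  have -> : rho%:num / (rho%:num / 4) = 4 by field; exact: lt0r_neq0.
  have := sum_model_weights_le g_ge0 w_g U0 g_le k sd (ltr0n _ 4) U12.
  set W := \sum_(_ | _) _ => WU.
  have X0 : 0 < 1 + L / rho%:num ^+ 2 by rewrite ltr_pwDl.
  apply: (@le_trans _ _ (expR e * (1 + L / rho%:num ^+ 2) ^+ s /
      (w (delta_star theta_star))%:num * (2 * (4 ^+ s * (4 * U) ^+ k * g s)))).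
    by rewrite ler_wpM2l// divr_ge0// mulr_ge0 ?expR_ge0// exprn_ge0// ltW.
  have -> : 4 + 4 * L / rho%:num ^+ 2 = 4 * (1 + L / rho%:num ^+ 2).
    by rewrite mulrDr mulr1 mulrA.
  rewrite wE -[4 * c2 / _]mulrA -/U [(4 * (1 + _)) ^+ _]exprMn.
  rewrite le_eqVlt; apply/orP; left; apply/eqP.
  move: (4 ^+ s) ((_ * U) ^+ k) ((1 + _) ^+ s) => p1 p2 p3; field.
  by rewrite !lt0r_neq0.
- move=> E M0 M2; cbv zeta beta; set c0 := cone_const Theta.
  have mE : measurable E.
    apply: measurableI; first apply: measurableI.
    + exact: measurable_E0.
    + exact: measurable_E1_hat.
    + exact: measurable_E1_check.
  set S := (\sum_(1 <= j <oo) (_ * _)%:E)%E.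
  set cst := 2 * _ * _ * _.
  have cst0 : 0 < cst.
    by rewrite !mulr_gt0// exprn_gt0// ltr_pwDl.
  set SD := (\sum_(1 <= j <oo) (packing _ _ * _))%E.
  have SD0 : (0 <= SD)%E.
    by apply: nneseries_ge0 => j _ _; rewrite mule_ge0 ?packing_ge0// lee_fin expR_ge0.
  have P0 : (0 <= P (~` E))%E by [].
  (* The shell index depends on theta; bounding a single term by the whole series gives a constant
     valid for all theta. *)
  have termS j : (1 <= j)%N -> ((expR (- (r (j%:R * M0 * eps / 2) / 8)) *
       expR (3 * rho%:num * c0 * j%:R * M0 * eps))%:E <= S)%E.
    move=> j1; set u := fun j : nat => (expR (- (r (j%:R * M0 * eps / 2) / 8)) *
      expR (3 * rho%:num * c0 * j%:R * M0 * eps))%:E.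
    have u0 i : (0 <= u i)%E by rewrite lee_fin mulr_ge0 ?expR_ge0.
    apply: le_trans (@nneseries_lim_ge _ u xpredT 1 j.+1 (fun i _ _ => u0 i)).
    by rewrite big_nat_recr//= leeDr// sume_ge0.
  have S0 : (0 <= S)%E.
    by apply: nneseries_ge0 => j _ _; rewrite lee_fin mulr_ge0 ?expR_ge0.
  case SE : S S0 => [S1| |]//; last first.
    move=> _; rewrite gt0_muley ?lte_fin// addey ?leey//.
    by rewrite gt_eqF// (lt_le_trans (ltNyr 0))// adde_ge0.
  rewrite lee_fin => S10.
  have M0p : 0 < M0 by rewrite (lt_trans _ M2).
  (* With eps = 0 every term of the series would equal 1, so the series would diverge, against
     [SE]. *)
  have eps0 : 0 < eps.
    rewrite lt_neqAle -lee_fin -phi_eps phi_rate_ge0 andbT; apply/eqP => e0.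
    move: SE; rewrite /S; have [_ _ _ r0 _] := r_rate.
    rewrite (eq_eseriesr (g := fun=> (1 : R)%:E)) ?sum_one_pinfty// => j _.
    by rewrite -e0 !(mulr0, mul0r) r0 mul0r oppr0 expR0 mulr1.
  rewrite -EFinM; apply: (@le_trans _ _ (P (~` E) + (cst * S1)%:E)%E); last first.
    by rewrite -addeA leeD2l// leeDr.
  apply: (integral_le_good_event _ mE mB PB0) => [|z|z nB|z nB [[Hg Hh] Hc]].
  + by rewrite mulr_ge0// ltW.
  + exact: quasi_posterior_ge0.
  + exact: quasi_posterior_le1 (q_intB _ nB).
  have k2 : 0 < rho%:num / 2 by rewrite divr_gt0.
  have := quasi_posterior_le q_gt0 mq (m := 0) (A := [set theta |
      translate theta_star Theta theta /\ M0 * eps < l2 (theta - theta_star)])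
    (q_intB _ nB) S10 k2 L_ge0 w0 (fun _ _ => isT) _ Hh.
  move=> /(_ _)/le_trans; apply.
    move=> theta [tT far].
    have [j j0] := exists_shell (mulr_gt0 M0p eps0) far; rewrite !mulrA => shell.
    have := cone_bound q_gt0 Theta_cone rho0 lambda_ge0 eps0 M2 r_rate phi_eps
      Hg Hc tT j0 shell.
    move=> /le_trans; apply; rewrite ler_wpM2r ?expR_ge0// ler_wpM2r ?(ltW (q_gt0 _ _))//.
    by have := termS j j0; rewrite SE lee_fin.
  rewrite lee_fin.
  have -> : rho%:num / (rho%:num / 2) = 2 by field; exact: lt0r_neq0.
  have U2 : 2 * U <= 2^-1 by lra.
  (* All models enter here, so the sum is compared with g 0; g s, contained in the weight of the
     true model, is then recovered at the cost V^s. *)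
  have := sum_model_weights_le g_ge0 w_g U0 g_le 0 (leq0n d) (ltr0n _ 2) U2.
  rewrite addn0 !expr0 !mul1r; set W := \sum_(_ | _) _ => WU.
  have gV : g 0 <= V ^+ s * g s := g0_le_expV V0 g_ge sd.
  have X0 : 0 < 1 + L / rho%:num ^+ 2 by rewrite ltr_pwDl.
  apply: (@le_trans _ _ (S1 * (1 + L / rho%:num ^+ 2) ^+ s /
      (w (delta_star theta_star))%:num * (2 * (V ^+ s * g s)))).
    rewrite ler_wpM2l//; first by rewrite divr_ge0// mulr_ge0// exprn_ge0// ltW.
    by apply: (le_trans WU); rewrite ler_pM2l.
  rewrite wE /cst -/V le_eqVlt; apply/orP; left; apply/eqP.
  move: (V ^+ s) ((1 + _) ^+ s) => p1 p2; field.
  by rewrite !lt0r_neq0.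
Qed.
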